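(* Let $G$ be the Cayley graph of a finitely generated infinite group, and let $\lambda_{\max}=\sup\sigma(A_G)$ be the supremum of the spectrum of its adjacency operator. Then the distribution of a (nontrivial) Gaussian wave function on $G$ with eigenvalue $\lambda_{\max}$ can never be obtained as the distribution of a factor of i.i.d. process on $G$.
   Context: The Cayley graph of an infinite group $\Gamma$ with respect to a finite symmetric generating set $S$ has vertex set $\Gamma$, with $v$ adjacent to $\gamma v$ for each $\gamma\in S$. The adjacency operator $A_G:\ell_2(V(G))\to\ell_2(V(G))$ is $(A_Gf)(v)=\sum_{u\in N(v)}f(u)$, where $N(v)$ is the set of neighbors of $v$. A Gaussian process on $G$ is a collection of jointly Gaussian, centered random variables $X_v$, $v\in V(G)$; it is invariant if for every $\Phi\in\mathrm{Aut}(G)$ the process $(X_{\Phi(v)})_v$ has the same joint distribution as $(X_v)_v$. A Gaussian wave function with eigenvalue $\lambda$ is an invariant Gaussian process with $\sum_{u\in N(v)}X_u=\lambda X_v$ for each vertex $v$. Nontrivial means not almost surely identically zero. Let $\Omega=\mathbb{R}^{V(G)}$ with the product topology and let $Z=(Z_v)_{v\in V(G)}$ be independent standard normal random variables. $\mathrm{Aut}(G)$ acts on $\Omega$ by $(\Phi\cdot\omega)_v=\omega_{\Phi^{-1}v}$. A factor of i.i.d. process on $G$ is a process $X=F(Z)$, where $F:\Omega\to\Omega$ is measurable and $\mathrm{Aut}(G)$-equivariant. *)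

(* Defs.v *)
From mathcomp Require Import all_boot all_order all_algebra.
From mathcomp Require Import all_classical all_reals all_analysis.

Set Implicit Arguments.
Unset Strict Implicit.
Unset Printing Implicit Defensive.

Import Order.TTheory GRing.Theory Num.Theory.
Import numFieldNormedType.Exports.

Local Open Scope classical_set_scope.
Local Open Scope ring_scope.

Section Cayley.
Variable Gam : groupType.
Implicit Type S : set Gam.

Definition symmetric_set S := forall s, S s -> S (s^-1)%g.

Definition generates S := forall H : set Gam,
  S `<=` H -> H 1%g ->
  (forall x y, H x -> H y -> H (x * y)%g) ->
  (forall x, H x -> H (x^-1)%g) ->
  H = [set: Gam].

(* If [S 1%g] holds then every vertex carries a loop and is its own neighbor. *)
Definition cayley S (v u : Gam) : Prop := exists2 s, S s & u = (s * v)%g.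

End Cayley.

(* A graph is given by its adjacency relation. *)
Section Graph.
Variables (V : choiceType) (adj : V -> V -> Prop).

Definition neighbors (v : V) : set V := [set u | adj v u].

Record automorphism := Automorphism {
  aut_fun :> V -> V;
  aut_inv : V -> V;
  aut_funK : cancel aut_fun aut_inv;
  aut_invK : cancel aut_inv aut_fun;
  aut_adj : forall u v, adj (aut_fun u) (aut_fun v) <-> adj u v }.

End Graph.

Section Spectrum.
Variables (R : realType) (V : choiceType).
Implicit Types (f g : V -> R) (T B : (V -> R) -> (V -> R)).

(* The square of the l2 norm, possibly +oo. *)
Definition sqnorm2 f : \bar R := \esum_(v in [set: V]) ((f v) ^+ 2)%:E.

Definition ell2 : set (V -> R) := [set f | (sqnorm2 f < +oo)%E].

Definition bounded_operator B : Prop :=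
  [/\ forall f, ell2 f -> ell2 (B f),
      forall (a : R) f g, ell2 f -> ell2 g ->
        B (fun v => a * f v + g v) = (fun v => a * B f v + B g v)
    & exists C : R, forall f, ell2 f -> (sqnorm2 (B f) <= C%:E * sqnorm2 f)%E].

(* Spectrum of an operator on the real Hilbert space l2(V). Operators are total
   maps on [V -> R] of which only the restriction to [ell2] matters. *)
Definition spectrum T : set R := [set l | ~ exists B,
  [/\ bounded_operator B,
      forall f, ell2 f -> B (fun v => T f v - l * f v) = f
    & forall f, ell2 f -> (fun v => T (B f) v - l * B f v) = f]].

(* The finitely supported sum is the intended one as soon as all
   neighborhoods are finite, e.g. for [cayley S] with [S] finite. *)
Definition adjacency (adj : V -> V -> Prop) f : V -> R :=
  fun v => \sum_(u \in neighbors adj v) f u.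

Definition lambda_max (adj : V -> V -> Prop) : R :=
  sup (spectrum (adjacency adj)).

End Spectrum.

(* The space R^V with the Borel sigma-algebra of the product topology. *)
Definition Omega (R : realType) (V : choiceType) :=
  g_sigma_algebraType (@open {ptws V -> R}).

Section Processes.
Variables (R : realType) (V : choiceType).
Local Open Scope ereal_scope.

Definition sample_path d (T : measurableType d) (P : probability T R)
    (X : V -> {RV P >-> R}) (t : T) : Omega R V := fun v => X v t.

Definition same_law d (T : measurableType d) (P : probability T R)
    d' (T' : measurableType d') (P' : probability T' R)
    (X : T -> Omega R V) (Y : T' -> Omega R V) : Prop :=
  forall A : set (Omega R V), measurable A -> P (X @^-1` A) = P' (Y @^-1` A).

(* N(0, s^2); the library's [normal_prob] does not cover the degenerate case. *)
Definition centered_normal (s : R) (B : set R) : \bar R :=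
  if s == 0%R then \d_(0%R : R) B else normal_prob 0%R s B.

Definition gaussian_process d (T : measurableType d) (P : probability T R)
    (X : V -> {RV P >-> R}) : Prop :=
  forall (s : seq V) (c : V -> R), exists sigma : R,
    forall B : set R, measurable B ->
      P [set t | B (\sum_(v <- s) c v * X v t)%R] = centered_normal sigma B.

Definition iid_standard_normal d (T : measurableType d) (P : probability T R)
    (Z : V -> {RV P >-> R}) : Prop :=
  (forall v (B : set R), measurable B -> P (Z v @^-1` B) = normal_prob 0%R 1%R B)
  /\ (forall (s : seq V) (B : V -> set R), uniq s ->
        (forall v, measurable (B v)) ->
        P (\bigcap_(v in [set` s]) (Z v @^-1` B v)) =
        \prod_(v <- s) P (Z v @^-1` B v)).

Variable adj : V -> V -> Prop.

Definition invariant_process d (T : measurableType d) (P : probability T R)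
    (X : V -> {RV P >-> R}) : Prop :=
  forall Phi : automorphism adj,
    same_law P P (sample_path (X \o Phi)) (sample_path X).

Definition gaussian_wave_function d (T : measurableType d)
    (P : probability T R) (lambda : R) (X : V -> {RV P >-> R}) : Prop :=
  [/\ gaussian_process X, invariant_process X
    & forall v, {ae P, forall t,
        (\sum_(u \in neighbors adj v) X u t = lambda * X v t)%R}].

Definition nontrivial d (T : measurableType d) (P : probability T R)
    (X : V -> {RV P >-> R}) : Prop :=
  ~ {ae P, forall t, forall v, X v t = 0%R}.

Definition act (Phi : automorphism adj) (w : Omega R V) : Omega R V :=
  fun v => w (aut_inv Phi v).

Definition equivariant (F : Omega R V -> Omega R V) : Prop :=
  forall (Phi : automorphism adj) w, F (act Phi w) = act Phi (F w).

Definition law_of_iid_factor d (T : measurableType d) (P : probability T R)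
    (X : V -> {RV P >-> R}) : Prop :=
  exists (d' : measure_display) (T' : measurableType d')
    (P' : probability T' R) (Z : V -> {RV P' >-> R})
    (F : Omega R V -> Omega R V),
    [/\ iid_standard_normal Z, measurable_fun setT F, equivariant F
      & same_law P P' (sample_path X) (F \o sample_path Z)].

End Processes.

(* Main.v *)
Require Import Defs.
From mathcomp Require Import all_boot all_order all_algebra.
From mathcomp Require Import all_classical all_reals all_analysis.
From mathcomp Require Import measurable_realfun ring lra.

(** Suppose the wave function X is distributed as F(Z). Under right translations
    the value F(Z)_v is F(Z)_1 evaluated at the translated field. For a cylinder
    event C with centred indicator phi = 1_C - P(C), put h(v) = E[F(Z)_v phi(Z)].
    Translates of phi involving disjoint sets of coordinates are orthogonal, so
    the translates of phi form an almost orthogonal family and Bessel's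
    inequality puts h in l2. The wave equation makes h an eigenvector of the
    adjacency operator for lambda_max. On an infinite group there is no such
    nonzero eigenvector: lambda_max bounds the quadratic form of A, so |h| is
    again an eigenvector (Perron-Frobenius), nonnegative eigenvectors vanish
    everywhere or nowhere, hence |h| coincides with each of its right translates,
    and a square summable constant vanishes. So F(Z)_v is uncorrelated with all
    cylinder events, i.e. almost surely constant, and a centred Gaussian that is
    constant is zero. *)

Set Implicit Arguments.
Unset Strict Implicit.
Unset Printing Implicit Defensive.

Import Order.TTheory GRing.Theory Num.Theory.
Import numFieldNormedType.Exports.

Local Open Scope classical_set_scope.
Local Open Scope ring_scope.

(** * Real summation over a discrete set *)

Section RealSummation.
Context {R : realType} {I : choiceType}.
Implicit Types (f g : I -> R).

Definition asum f := summable [set: I] (EFin \o f).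

(* Meaningful only when [asum f] holds: [fine] sends infinities to 0. *)
Definition rsum f : R :=
  fine (\esum_(i in [set: I]) (Num.max (f i) 0)%:E) -
  fine (\esum_(i in [set: I]) (Num.max (- f i) 0)%:E).

Lemma asum_esum f : (forall i, 0 <= f i) ->
  asum f = (\esum_(i in [set: I]) (f i)%:E < +oo)%E.
Proof.
move=> f0; rewrite /asum /summable; congr (_ < _)%E.
by apply: eq_esum => i _ /=; rewrite ger0_norm.
Qed.

Lemma asum_le f g : (forall i, `|f i| <= `|g i|) -> asum g -> asum f.
Proof. by move=> fg; apply: le_lt_trans; apply: le_esum => i _; rewrite /= lee_fin. Qed.

Lemma asumD f g : asum f -> asum g -> asum (fun i => f i + g i).
Proof. exact: summableD. Qed.

Lemma asum_fin f : (forall i, 0 <= f i) -> asum f ->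
  \esum_(i in [set: I]) (f i)%:E = (fine (\esum_(i in [set: I]) (f i)%:E))%:E.
Proof.
move=> f0; rewrite asum_esum// => h; rewrite fineK// ge0_fin_numE//.
by apply: esum_ge0 => i _; rewrite lee_fin.
Qed.

Lemma ge0_esumZ f a : (forall i, 0 <= f i) -> 0 <= a ->
  \esum_(i in [set: I]) (a * f i)%:E = (a%:E * \esum_(i in [set: I]) (f i)%:E)%E.
Proof.
move=> f0 a0; rewrite /esum -ereal_supZl//; last first.
  apply/set0P; exists (\sum_(x \in set0) (f x)%:E)%E.
  by exists set0; first exact: fsets_set0.
congr ereal_sup; apply/seteqP; split => x /=.
  move=> [A AI <-]; exists (\sum_(i \in A) (f i)%:E)%E; first by exists A.
  by rewrite ge0_mule_fsumr// => i; rewrite lee_fin.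
move=> [_ [A AI <-] <-]; exists A => //.
by rewrite ge0_mule_fsumr// => i; rewrite lee_fin.
Qed.

Lemma asumZ f a : asum f -> asum (fun i => a * f i).
Proof.
move=> hf; rewrite /asum /summable.
under eq_esum do rewrite /= normrM.
rewrite ge0_esumZ//; move: hf; rewrite /asum summableE /= => h.
by rewrite -ge0_fin_numE ?fin_numM// mule_ge0// esum_ge0.
Qed.

Lemma asumN f : asum f -> asum (fun i => - f i).
Proof. by apply: asum_le => i; rewrite normrN. Qed.

Lemma asumB f g : asum f -> asum g -> asum (fun i => f i - g i).
Proof. by move=> hf hg; apply: asumD => //; apply: asumN. Qed.

Lemma ge0_rsum f : (forall i, 0 <= f i) ->
  rsum f = fine (\esum_(i in [set: I]) (f i)%:E).
Proof.
move=> f0; rewrite /rsum [X in _ - fine X]esum1 ?subr0.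
  by congr fine; apply: eq_esum => i _; rewrite max_l.
by move=> i _; rewrite max_r// oppr_le0.
Qed.

Lemma rsum_ge0 f : (forall i, 0 <= f i) -> 0 <= rsum f.
Proof.
by move=> f0; rewrite ge0_rsum// fine_ge0// esum_ge0// => i _; rewrite lee_fin.
Qed.

Lemma ge0_rsumD f g : (forall i, 0 <= f i) -> (forall i, 0 <= g i) ->
  asum f -> asum g -> rsum (fun i => f i + g i) = rsum f + rsum g.
Proof.
move=> f0 g0 hf hg; rewrite !ge0_rsum//; last by move=> i; rewrite addr_ge0.
under eq_esum do rewrite EFinD.
rewrite esumD; last 2 first.
- by move=> i _; rewrite lee_fin.
- by move=> i _; rewrite lee_fin.
by rewrite asum_fin// (asum_fin g0)//.
Qed.

Lemma rsum_pn f :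
  rsum f = rsum (fun i => Num.max (f i) 0) - rsum (fun i => Num.max (- f i) 0).
Proof.
rewrite (@ge0_rsum (fun i => Num.max (f i) 0)) ?(@ge0_rsum (fun i => Num.max (- f i) 0))//.
all: by move=> i; rewrite le_max lexx orbT.
Qed.

Lemma asum_pos f : asum f -> asum (fun i => Num.max (f i) 0).
Proof.
apply: asum_le => i; rewrite ger0_norm ?le_max ?lexx ?orbT//.
by rewrite ge_max ler_norm normr_ge0.
Qed.

(** The positive and negative parts [p], [n] of [f - g] satisfy [p + g = n + f], so additivity for
    nonnegative functions suffices. *)
Lemma rsum_sub f g : (forall i, 0 <= f i) -> (forall i, 0 <= g i) ->
  asum f -> asum g -> rsum (fun i => f i - g i) = rsum f - rsum g.
Proof.
move=> f0 g0 hf hg; have hB := asumB hf hg; rewrite rsum_pn.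
pose p i := Num.max (f i - g i) 0; pose n i := Num.max (- (f i - g i)) 0.
rewrite -/p -/n.
have p0 i : 0 <= p i by rewrite /p le_max lexx orbT.
have n0 i : 0 <= n i by rewrite /n le_max lexx orbT.
have hp : asum p by exact: asum_pos.
have hn : asum n by apply: asum_pos; exact: asumN.
have : rsum (fun i => p i + g i) = rsum (fun i => n i + f i).
  congr rsum; apply/funext => i; rewrite /p /n.
  case: (lerP 0 (f i - g i)) => h.
    by rewrite max_r ?oppr_le0//; ring.
  by rewrite max_l ?oppr_ge0 ?ltW//; ring.
by rewrite !ge0_rsumD//; lra.
Qed.

Lemma rsumD f g : asum f -> asum g -> rsum (fun i => f i + g i) = rsum f + rsum g.
Proof.
move=> hf hg.
pose p (u : I -> R) i := Num.max (u i) 0; pose n (u : I -> R) i := Num.max (- u i) 0.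
have p0 u i : 0 <= p u i by rewrite /p le_max lexx orbT.
have n0 u i : 0 <= n u i by rewrite /n le_max lexx orbT.
have hp u : asum u -> asum (p u) by exact: asum_pos.
have hn u : asum u -> asum (n u) by move=> hu; apply: asum_pos; exact: asumN.
have e (x : R) : x = Num.max x 0 - Num.max (- x) 0.
  case: (lerP 0 x) => h; first by rewrite max_r ?oppr_le0// subr0.
  by rewrite max_l ?oppr_ge0 ?ltW//; ring.
have -> : (fun i => f i + g i) = (fun i => (p f i + p g i) - (n f i + n g i)).
  by apply/funext => i; rewrite {1}(e (f i)) {1}(e (g i)) /p /n; ring.
rewrite rsum_sub; [|by move=> i; rewrite addr_ge0|by move=> i; rewrite addr_ge0
  |by apply: asumD; auto|by apply: asumD; auto].
rewrite !ge0_rsumD; auto.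
by rewrite (rsum_pn f) (rsum_pn g) -/(p f) -/(n f) -/(p g) -/(n g); ring.
Qed.

Lemma rsumN f : rsum (fun i => - f i) = - rsum f.
Proof.
rewrite rsum_pn (rsum_pn f) [RHS]opprB; congr (_ - _).
by congr rsum; apply/funext => i; rewrite opprK.
Qed.

Lemma rsumB f g : asum f -> asum g -> rsum (fun i => f i - g i) = rsum f - rsum g.
Proof. by move=> hf hg; rewrite rsumD ?rsumN//; exact: asumN. Qed.

(** This holds even without summability: [fine] sends an infinite sum to 0, and scaling fixes 0. *)
Lemma rsumZ f a : rsum (fun i => a * f i) = a * rsum f.
Proof.
wlog a0 : a / 0 <= a => [h|].
  have [a0|a0] := lerP 0 a; first exact: h.
  rewrite -[a]opprK mulNr -h ?oppr_ge0 ?ltW// -rsumN.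
  by congr rsum; apply/funext => i; rewrite mulNr.
have key u : (forall i, 0 <= u i) -> rsum (fun i => a * u i) = a * rsum u.
  move=> u0; rewrite !ge0_rsum//; last by move=> i; rewrite mulr_ge0.
  rewrite ge0_esumZ//.
  case E : (\esum_(i in [set: I]) (u i)%:E) => [r| |] //=.
    rewrite mulr0; have [->|an0] := eqVneq a 0; first by rewrite mul0e.
    by rewrite mulry gtr0_sg ?lt_def ?an0// mul1e.
  have := @esum_ge0 R I setT (EFin \o u) (fun i _ => u0 i).
  by rewrite /= E.
rewrite rsum_pn (rsum_pn f) mulrBr -!key; last 2 first.
- by move=> i; rewrite le_max lexx orbT.
- by move=> i; rewrite le_max lexx orbT.
by congr (_ - _); congr rsum; apply/funext => i; rewrite maxr_pMr// mulr0// mulrN.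
Qed.

Lemma le_rsum f g : asum f -> asum g -> (forall i, f i <= g i) -> rsum f <= rsum g.
Proof.
move=> hf hg fg; rewrite -subr_ge0 -rsumB//.
by apply: rsum_ge0 => i; rewrite subr_ge0.
Qed.

Lemma rsum0 : rsum (fun=> 0) = 0.
Proof. by rewrite ge0_rsum// esum1. Qed.

Lemma asum0 : asum (fun=> 0).
Proof. by rewrite asum_esum// esum1. Qed.

Lemma rsum_term f i : (forall j, 0 <= f j) -> asum f -> f i <= rsum f.
Proof.
move=> f0 hf; rewrite ge0_rsum// -lee_fin -asum_fin//.
apply: esum_ge; exists [set i]; last by rewrite fsbig_set1.
by split => //; exact: finite_set1.
Qed.

Lemma asum_bij (h h' : I -> I) f : cancel h h' -> cancel h' h ->
  asum f -> asum (fun i => f (h i)).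
Proof.
move=> hK h'K; rewrite /asum /summable (reindex_esum setT setT h)//.
by rewrite setTT_bijective; exists h'.
Qed.

Lemma rsum_bij (h h' : I -> I) f : cancel h h' -> cancel h' h ->
  rsum (fun i => f (h i)) = rsum f.
Proof.
move=> hK h'K; have b : set_bij [set: I] [set: I] h.
  by rewrite setTT_bijective; exists h'.
rewrite /rsum; congr (fine _ - fine _).
  by rewrite (reindex_esum setT setT h (fun i => (Num.max (f i) 0)%:E)).
by rewrite (reindex_esum setT setT h (fun i => (Num.max (- f i) 0)%:E)).
Qed.

Lemma asum_bound f M : (forall i, 0 <= f i) ->
  (forall s : seq I, uniq s -> \sum_(i <- s) f i <= M) ->
  asum f /\ rsum f <= M.
Proof.
move=> f0 H.
have : (\esum_(i in [set: I]) (f i)%:E <= M%:E)%E.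
  apply: ge_ereal_sup => _ [A [finA _] <-].
  rewrite fsbig_finite//= sumEFin lee_fin; apply: H; exact: finmap.fset_uniq.
move=> h; have hf : asum f by rewrite asum_esum// (le_lt_trans h)// ltry.
by split=> //; rewrite ge0_rsum// -lee_fin -asum_fin.
Qed.

Lemma rsum_seq f (s : seq I) : (forall i, 0 <= f i) -> asum f -> uniq s ->
  \sum_(i <- s) f i <= rsum f.
Proof.
move=> f0 hf us; rewrite ge0_rsum// -lee_fin -asum_fin// -sumEFin.
apply: esum_ge; exists [set` s]; first by split.
by rewrite fsbig_seq.
Qed.

End RealSummation.

(** * The Hilbert space l2 and the adjacency operator *)

Section Ell2.
Context {R : realType} {V : choiceType}.
Implicit Types (f g h : V -> R).

Definition ip f g : R := rsum (fun v => f v * g v).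

Lemma ell2E f : ell2 f <-> asum (fun v => f v ^+ 2).
Proof. by rewrite asum_esum// => i; exact: sqr_ge0. Qed.

Lemma asumM f g : ell2 f -> ell2 g -> asum (fun v => f v * g v).
Proof.
move=> /ell2E hf /ell2E hg; apply: asum_le (asumD hf hg) => v.
rewrite [leRHS]ger0_norm ?addr_ge0 ?sqr_ge0// ler_norml.
by apply/andP; split; nra.
Qed.

Lemma ell2_lin (a : R) f g : ell2 f -> ell2 g -> ell2 (fun v => a * f v + g v).
Proof.
move=> hf hg; apply/ell2E.
have -> : (fun v => (a * f v + g v) ^+ 2) =
    (fun v => (a ^+ 2 * (f v * f v) + (2 * a) * (f v * g v)) + g v * g v).
  by apply/funext => v; ring.
apply: (asumD (asumD (asumZ _ (asumM hf hf)) (asumZ _ (asumM hf hg)))).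
exact: asumM.
Qed.

Lemma ell2_0 : ell2 (fun _ : V => 0 : R).
Proof. by apply/ell2E; rewrite expr0n; exact: asum0. Qed.

Lemma ell2Z (a : R) f : ell2 f -> ell2 (fun v => a * f v).
Proof.
move=> hf; have := ell2_lin a hf ell2_0.
by under eq_fun do rewrite addr0.
Qed.

Lemma ell2D f g : ell2 f -> ell2 g -> ell2 (fun v => f v + g v).
Proof.
move=> hf hg; have := ell2_lin 1 hf hg.
by under eq_fun do rewrite mul1r.
Qed.

Lemma ell2B f g : ell2 f -> ell2 g -> ell2 (fun v => f v - g v).
Proof.
move=> hf hg; have := ell2_lin (-1) hg hf.
by under eq_fun do rewrite mulN1r addrC.
Qed.

Lemma ell2_le f g : (forall v, `|f v| <= `|g v|) -> ell2 g -> ell2 f.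
Proof.
move=> fg /ell2E hg; apply/ell2E; apply: asum_le hg => v.
by rewrite !normrX lerXn2r ?nnegrE.
Qed.

Lemma ell2_bij (b b' : V -> V) f : cancel b b' -> cancel b' b ->
  ell2 f -> ell2 (fun v => f (b v)).
Proof.
move=> bK b'K /ell2E hf; apply/ell2E.
exact: (asum_bij (f := fun v => f v ^+ 2) bK b'K).
Qed.

Lemma ip_bij (b b' : V -> V) f g : cancel b b' -> cancel b' b ->
  ip (fun v => f (b v)) (fun v => g (b v)) = ip f g.
Proof. by move=> bK b'K; exact: (rsum_bij (fun v => f v * g v) bK b'K). Qed.

Lemma ipC f g : ip f g = ip g f.
Proof. by congr rsum; apply/funext => v; rewrite mulrC. Qed.

Lemma ip_lin (a : R) f g h : ell2 f -> ell2 g -> ell2 h ->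
  ip (fun v => a * f v + g v) h = a * ip f h + ip g h.
Proof.
move=> hf hg hh.
have e : (fun v => (a * f v + g v) * h v) =
    (fun v => a * (f v * h v) + g v * h v).
  by apply/funext => v; ring.
by rewrite /ip e (rsumD (asumZ a (asumM hf hh)) (asumM hg hh)) rsumZ.
Qed.

Lemma ipZl (a : R) f h : ip (fun v => a * f v) h = a * ip f h.
Proof. by rewrite /ip -rsumZ; congr rsum; apply/funext => v; ring. Qed.

Lemma ipDl f g h : ell2 f -> ell2 g -> ell2 h ->
  ip (fun v => f v + g v) h = ip f h + ip g h.
Proof.
move=> hf hg hh; rewrite -[ip f h]mul1r -ip_lin//
  (_ : (fun v => f v + g v) = fun v => 1 * f v + g v)//.
by apply/funext => v; rewrite mul1r.
Qed.

Lemma ipBl f g h : ell2 f -> ell2 g -> ell2 h ->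
  ip (fun v => f v - g v) h = ip f h - ip g h.
Proof.
move=> hf hg hh; rewrite addrC -mulN1r -ip_lin//
  (_ : (fun v => f v - g v) = fun v => -1 * g v + f v)//.
by apply/funext => v; rewrite mulN1r addrC.
Qed.

Lemma ipBB f1 g1 f2 g2 : ell2 f1 -> ell2 g1 -> ell2 f2 -> ell2 g2 ->
  ip (fun v => f1 v - g1 v) (fun v => f2 v - g2 v) =
  ip f1 f2 - ip f1 g2 - ip g1 f2 + ip g1 g2.
Proof.
move=> hf1 hg1 hf2 hg2; have h2 := ell2B hf2 hg2.
rewrite (ipBl hf1 hg1 h2) (ipC f1) (ipC g1).
by rewrite !ipBl// (ipC f2 f1) (ipC g2 f1) (ipC f2 g1) (ipC g2 g1); ring.
Qed.

Lemma ipB2 f g : ell2 f -> ell2 g ->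
  ip (fun v => f v - g v) (fun v => f v - g v) = ip f f - 2 * ip f g + ip g g.
Proof. by move=> hf hg; rewrite ipBB// (ipC g f); ring. Qed.

Lemma ipD2 f g : ell2 f -> ell2 g ->
  ip (fun v => f v + g v) (fun v => f v + g v) = ip f f + 2 * ip f g + ip g g.
Proof.
move=> hf hg; have h := ell2D hf hg.
rewrite (ipDl hf hg h) (ipC f) (ipC g).
by rewrite !ipDl// (ipC g f); ring.
Qed.

Lemma ip0l h : ip (fun=> 0) h = 0.
Proof.
rewrite /ip -[RHS](@rsum0 R V); congr rsum.
by apply/funext => v; rewrite mul0r.
Qed.

Lemma ip_ge0 f : 0 <= ip f f.
Proof. by apply: rsum_ge0 => v; rewrite -expr2 sqr_ge0. Qed.

Lemma ip_term f v : ell2 f -> f v ^+ 2 <= ip f f.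
Proof.
move=> hf; apply: (rsum_term (f := fun v => f v * f v)); last exact: asumM.
by move=> w; rewrite -expr2 sqr_ge0.
Qed.

Lemma ip_eq0 f : ell2 f -> ip f f <= 0 -> forall v, f v = 0.
Proof.
move=> hf h v; apply/eqP; rewrite -sqrf_eq0 eq_le sqr_ge0 andbT.
exact: le_trans (ip_term v hf) h.
Qed.

Lemma sqnorm2E f : ell2 f -> sqnorm2 f = (ip f f)%:E.
Proof.
move=> hf; rewrite /sqnorm2.
rewrite (eq_esum (b := fun v => (f v * f v)%:E)); last by move=> v _; rewrite expr2.
rewrite asum_fin.
- by rewrite /ip ge0_rsum// => v; rewrite -expr2 sqr_ge0.
- by move=> v; rewrite -expr2 sqr_ge0.
- exact: asumM.
Qed.

Lemma le_ip_ell2 f g h : ell2 f -> ell2 g -> ell2 h -> (forall v, 0 <= h v) ->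
  (forall v, f v <= g v) -> ip f h <= ip g h.
Proof.
move=> hf hg hh h0 fg; apply: le_rsum; [exact: asumM..|].
by move=> v; rewrite ler_wpM2r.
Qed.

End Ell2.

Section AdjacencyOperator.
Context {R : realType} {Gam : groupType}.
Implicit Types (f g : Gam -> R) (l : seq Gam).

(** Summing over a list allows induction on the generators; [sum_neighbors] identifies the result
    with the adjacency operator when the list enumerates [S]. *)
Definition adjop l f (v : Gam) : R := \sum_(s <- l) f (s * v)%g.

Lemma adjop_lin l (a : R) f g :
  adjop l (fun v => a * f v + g v) = (fun v => a * adjop l f v + adjop l g v).
Proof. by apply/funext => v; rewrite /adjop big_split /= mulr_sumr. Qed.

Lemma adjopZ l (a : R) f : adjop l (fun v => a * f v) = (fun v => a * adjop l f v).
Proof. by apply/funext => v; rewrite /adjop mulr_sumr. Qed.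

Lemma adjopB l f g :
  adjop l (fun v => f v - g v) = (fun v => adjop l f v - adjop l g v).
Proof. by apply/funext => v; rewrite /adjop sumrB. Qed.

Lemma ell2_lmul (s : Gam) f : ell2 f -> ell2 (fun v => f (s * v)%g).
Proof. exact: (ell2_bij (mulKg s) (mulVKg s)). Qed.

Lemma ip_lmul (s : Gam) f g :
  ip (fun v => f (s * v)%g) g = ip f (fun v => g (s^-1 * v)%g).
Proof.
rewrite -(ip_bij f _ (mulKg s) (mulVKg s)).
by congr ip; apply/funext => v; rewrite mulKg.
Qed.

Lemma adjop_cons s l f :
  adjop (s :: l) f = (fun v => f (s * v)%g + adjop l f v).
Proof. by apply/funext => v; rewrite /adjop big_cons. Qed.

Lemma adjop_nil f : adjop [::] f = (fun=> 0).
Proof. by apply/funext => v; rewrite /adjop big_nil. Qed.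

Lemma ell2_adjop l f : ell2 f -> ell2 (adjop l f).
Proof.
move=> hf; elim: l => [|s l IH]; first by rewrite adjop_nil; exact: ell2_0.
by rewrite adjop_cons; apply: ell2D => //; exact: ell2_lmul.
Qed.

(** Translations are isometries of l2, and each further generator costs one use of
    [|a + b|^2 <= 2 |a|^2 + 2 |b|^2]. *)
Lemma adjop_bounded l : exists2 C : R, 0 <= C &
  forall f, ell2 f -> ip (adjop l f) (adjop l f) <= C * ip f f.
Proof.
elim: l => [|s l [C C0 IH]].
  by exists 0 => // f hf; rewrite adjop_nil mul0r ip0l.
exists (2 + 2 * C); first lra.
move=> f hf; rewrite adjop_cons.
have h1 := ell2_lmul s hf; have h2 := ell2_adjop l hf.
(* Parallelogram identity. *)
have : 0 <= ip (fun v => f (s * v)%g - adjop l f v) (fun v => f (s * v)%g - adjop l f v).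
  exact: ip_ge0.
rewrite ipB2// ipD2// (ip_bij f f (mulKg s) (mulVKg s)).
by have := IH f hf; lra.
Qed.

Lemma ip_adjopl l f g : ell2 f -> ell2 g ->
  ip (adjop l f) g = \sum_(s <- l) ip (fun v => f (s * v)%g) g.
Proof.
move=> hf hg; elim: l => [|s l IH].
  by rewrite big_nil adjop_nil ip0l.
by rewrite big_cons adjop_cons ipDl// ?IH//; [exact: ell2_lmul|exact: ell2_adjop].
Qed.

(** The adjoint of translation by [s] is translation by its inverse, and inversion only permutes the
    list. *)
Lemma adjop_sym l f g : perm_eq [seq (s^-1)%g | s <- l] l -> ell2 f -> ell2 g ->
  ip (adjop l f) g = ip f (adjop l g).
Proof.
move=> lV hf hg; rewrite (ipC f) !ip_adjopl//.
rewrite -(perm_big _ lV) big_map; apply: eq_bigr => s _.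
by rewrite ip_lmul invgK ipC.
Qed.

Lemma ell2_rmul (x : Gam) f : ell2 f -> ell2 (fun v => f (v * x)%g).
Proof. exact: (ell2_bij (mulgK x) (mulgVK x)). Qed.

Lemma adjop_rmul l (x : Gam) f :
  adjop l (fun v => f (v * x)%g) = (fun v => adjop l f (v * x)%g).
Proof. by apply/funext => v; apply: eq_bigr => s _; rewrite mulgA. Qed.

End AdjacencyOperator.

(** * The spectrum and the quadratic form *)

Section AdjacencySpectrum.
Context {R : realType} {Gam : groupType}.
Variable l : seq Gam.
Hypothesis lV : perm_eq [seq (s^-1)%g | s <- l] l.
Implicit Types (f g h w : Gam -> R).
Local Notation A := (@adjop R Gam l).

(* For a positive semidefinite T bounded by M, positivity of the form at
   [M f - T f] gives |T f|^2 <= M <T f, f>. *)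
Lemma psd_residual_bound (lam : R) :
  (forall f, ell2 f -> ip (A f) f <= lam * ip f f) ->
  exists2 M : R, 0 < M & forall f, ell2 f ->
    ip (fun v => lam * f v - A f v) (fun v => lam * f v - A f v) <=
    M * (lam * ip f f - ip (A f) f).
Proof.
move=> psd; have [C C0 HC] := @adjop_bounded R Gam l.
(* [M] bounds the form of [lam - A], since [- <A g, g> <= (|A g|^2 + |g|^2) / 2 <= (C + 1) / 2 *
   |g|^2]. *)
pose M := `|lam| + (C + 1) / 2 + 1.
have M0 : 0 < M by rewrite /M; have := normr_ge0 lam; lra.
exists M => // f hf; set g := fun v => lam * f v - A f v.
have hAf := ell2_adjop l hf.
have hg : ell2 g by apply: ell2B => //; exact: ell2Z.
have hAg := ell2_adjop l hg.
have hMf : ell2 (fun v => M * f v) by exact: ell2Z.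
have gg : ip g g = lam * ip f g - ip (A f) g.
  by rewrite {1}/g ipBl ?ipZl//; exact: ell2Z.
(* The body of [g] is forgotten and only [gg] kept, so that the rewrites below treat [g] as an
   atom. *)
move: g hg hAg gg => g hg hAg gg.
have := psd _ (ell2B hMf hg).
have hMAf : ell2 (fun v => M * A f v) by exact: ell2Z.
rewrite adjopB adjopZ ipB2// ipBB// !ipZl !(ipC _ (fun v => M * _ v)) !ipZl.
rewrite -(adjop_sym lV hf hg) (ipC f (A f)) => H.
have h2 : lam * ip g g - ip (A g) g <= M * ip g g.
  have := ip_ge0 (fun v => A g v + g v).
  rewrite ipD2//.
  have := HC g hg; have := ip_ge0 g; have := ler_norm lam; rewrite /M; nra.
have : M * ip g g <= M * (M * (lam * ip f f - ip (A f) f)).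
  by nra.
by rewrite ler_pM2l.
Qed.

(** The iteration [u (k+1) = (A (u k) + f) / lam] started at 0 is monotone and bounded in l2. Its
    pointwise limit solves the equation, because [A] only involves finite sums; completeness of l2
    is not invoked. *)
Lemma resolvent_ge0 (C lam : R) f : 0 <= C ->
  (forall g, ell2 g -> ip (A g) (A g) <= C * ip g g) ->
  1 <= lam -> 2 * C + 2 <= lam ^+ 2 -> ell2 f -> (forall v, 0 <= f v) ->
  exists w, [/\ ell2 w, ip w w <= ip f f
    & forall v, lam * w v - A w v = f v].
Proof.
move=> C0 HC lam1 lamC hf f0.
have lam0 : 0 < lam by lra.
pose step (u : Gam -> R) v := lam^-1 * (A u v + f v).
pose u := fix u k := if k is k'.+1 then step (u k') else (fun=> 0).
have hu k : ell2 (u k) /\ ip (u k) (u k) <= ip f f.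
  elim: k => [|k [hk IH]].
    by split; [exact: ell2_0|rewrite ip0l ip_ge0].
  have hA := ell2_adjop l hk.
  split; first by apply: ell2Z; exact: ell2D.
  rewrite /= /step ipZl ipC ipZl mulrA -invfM -expr2 ler_pdivrMl ?exprn_gt0//.
  (* By the parallelogram identity [|A u + f|^2 <= 2 C |u|^2 + 2 |f|^2 <= (2 C + 2) |f|^2], which is
     where the lower bound on [lam ^+ 2] comes from. *)
  have := ip_ge0 (fun v => A (u k) v - f v).
  rewrite ipB2// ipD2//.
  have := HC _ hk; have := ip_ge0 f; have := ip_ge0 (u k); nra.
have mono k v : u k v <= u k.+1 v.
  elim: k v => [|k IH] v; rewrite /= /step.
    have -> : A (fun=> 0) v = 0 by rewrite /adjop big1.
    by rewrite add0r mulr_ge0// invr_ge0 ltW.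
  rewrite ler_pM2l ?invr_gt0// lerD2r.
  by apply: ler_sum => s _; exact: IH.
have nd v : nondecreasing_seq (u ^~ v) by apply/nondecreasing_seqP => k; exact: mono.
have ub v : has_ubound (range (u ^~ v)).
  (* From [x <= x^2 + 1] and [(u k v)^2 <= |f|^2]. *)
  exists (ip f f + 1) => _ [k _ <-].
  have [hk hkf] := hu k.
  by have := ip_term v hk; have := ip_ge0 f; nra.
pose w v : R := limn (u ^~ v).
have cw v : u k v @[k --> \oo] --> w v.
  exact: (nondecreasing_is_cvgn (nd v) (ub v)).
have csum (F : R -> R) (s : seq Gam) (e : Gam -> Gam) :
    (forall v, F (u k v) @[k --> \oo] --> F (w v)) ->
    (\sum_(x <- s) F (u k (e x))) @[k --> \oo] --> \sum_(x <- s) F (w (e x)).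
  move=> cF; elim: s => [|x s IH].
    by under eq_fun do rewrite big_nil; rewrite big_nil; exact: cvg_cst.
  under eq_fun do rewrite big_cons.
  rewrite big_cons; apply: cvgD IH.
  exact: cF.
have [hw wf] : asum (fun v => w v * w v) /\ ip w w <= ip f f.
  (* Fatou by hand: every finite partial sum for [w] is the limit of the partial sums for [u k], all
     at most [|f|^2]. *)
  apply: asum_bound => [v|s us]; first by rewrite -expr2 sqr_ge0.
  have cs : \sum_(x <- s) u k x * u k x @[k --> \oo] --> \sum_(x <- s) w x * w x.
    by apply: (csum (fun x => x * x) s id) => v; exact: cvgM.
  rewrite -(cvg_lim _ cs)//; apply: limr_le; first by apply/cvg_ex; eexists; exact: cs.
  near=> k.
  have [hk] := hu k; apply: le_trans; apply: rsum_seq => //; last exact: asumM.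
  by move=> v; rewrite -expr2 sqr_ge0.
exists w; split => //.
  by apply/ell2E; under eq_fun do rewrite expr2.
move=> v.
have c1 : u k.+1 v @[k --> \oo] --> w v by rewrite (cvg_shiftS (u ^~ v)); exact: cw.
have c2 : u k.+1 v @[k --> \oo] --> lam^-1 * (A w v + f v).
  rewrite /= /step; apply: cvgMr; apply: cvgD; last exact: cvg_cst.
  exact: (csum id l (fun s => (s * v)%g) cw).
rewrite (cvg_unique _ c1 c2)// mulrA divff ?gt_eqF// mul1r.
by rewrite -(_ : A (fun x => w x) v = A w v)//; lra.
Unshelve. all: by end_near.
Qed.

(** The positive and negative parts of [f] are solved separately. Their difference has squared norm
    at most [2 |f|^2], so the constant 4 is generous; the order [w2 - w1] accounts for the sign of
    [A - lam]. *)
Lemma resolvent (C lam : R) f : 0 <= C ->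
  (forall g, ell2 g -> ip (A g) (A g) <= C * ip g g) ->
  1 <= lam -> 2 * C + 2 <= lam ^+ 2 -> ell2 f ->
  exists w, [/\ ell2 w, ip w w <= 4 * ip f f
    & (fun v => A w v - lam * w v) = f].
Proof.
move=> C0 HC lam1 lamC hf.
pose p v := Num.max (f v) 0; pose n v := Num.max (- f v) 0.
have hp : ell2 p.
  apply: ell2_le hf => v; rewrite ger0_norm ?le_max ?lexx ?orbT//.
  by rewrite ge_max ler_norm normr_ge0.
have hn : ell2 n.
  apply: ell2_le hf => v; rewrite ger0_norm ?le_max ?lexx ?orbT//.
  by rewrite ge_max normr_ge0 -normrN ler_norm.
have [|w1 [h1 b1 e1]] := resolvent_ge0 C0 HC lam1 lamC hp.
  by move=> v; rewrite le_max lexx orbT.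
have [|w2 [h2 b2 e2]] := resolvent_ge0 C0 HC lam1 lamC hn.
  by move=> v; rewrite le_max lexx orbT.
have fpn v : f v = p v - n v.
  rewrite /p /n; case: (lerP 0 (f v)) => h; first by rewrite max_r ?oppr_le0// subr0.
  by rewrite max_l ?oppr_ge0 ?ltW//; ring.
have pn : ip p p + ip n n = ip f f.
  rewrite /ip -rsumD; [|exact: asumM|exact: asumM].
  congr rsum; apply/funext => v; rewrite /p /n.
  case: (lerP 0 (f v)) => h; first by rewrite max_r ?oppr_le0//; ring.
  by rewrite max_l ?oppr_ge0 ?ltW//; ring.
exists (fun v => w2 v - w1 v); split.
- exact: ell2B.
- have := ip_ge0 (fun v => w2 v + w1 v).
  rewrite ipD2// ipB2//; have := ip_ge0 f; lra.
- by apply/funext => v; rewrite adjopB fpn -e1 -e2; ring.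
Qed.

(** Above [2 * C + 2], [resolvent] supplies a bounded right inverse of [A - lam]; injectivity of
    [A - lam] makes it linear and a left inverse. Boundedness is what makes [sup (spectrum A)] a
    genuine upper bound. *)
Lemma spectrum_adjop_bounded : has_ubound (spectrum A).
Proof.
have [C C0 HC] := @adjop_bounded R Gam l.
exists (2 * C + 2) => lam sp; rewrite leNgt; apply/negP => lamC; apply: sp.
have lam1 : 1 <= lam by lra.
have lamC2 : 2 * C + 2 <= lam ^+ 2 by rewrite expr2; nra.
have [B HB] : exists B : (Gam -> R) -> (Gam -> R), forall f, ell2 f ->
    [/\ ell2 (B f), ip (B f) (B f) <= 4 * ip f f
      & (fun v => A (B f) v - lam * B f v) = f].
  have /choice[B HB] : forall f, exists w, ell2 f -> [/\ ell2 w, ip w w <= 4 * ip f f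
      & (fun v => A w v - lam * w v) = f].
    (* Outside [ell2] the required implication is vacuous, and [f] is an arbitrary value. *)
    move=> f; have [hf|hf] := pselect (ell2 f); last by exists f.
    by have [w hw] := resolvent C0 HC lam1 lamC2 hf; exists w.
  by exists B.
(* If [A w = lam w] then [lam^2 |w|^2 <= C |w|^2], whereas [lam^2 > C]. *)
have uniq0 w : ell2 w -> (fun v => A w v - lam * w v) = (fun=> 0) -> forall v, w v = 0.
  move=> hw e; apply: ip_eq0 => //.
  have Aw : A w = fun v => lam * w v.
    by apply/funext => v; have := congr1 (@^~ v) e; rewrite /=; lra.
  have := HC w hw; rewrite Aw ipZl ipC ipZl.
  by have := ip_ge0 w; nra.
have uniqw w w' : ell2 w -> ell2 w' ->
    (fun v => A w v - lam * w v) = (fun v => A w' v - lam * w' v) -> w = w'.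
  move=> hw hw' e; apply/funext => v; apply/eqP; rewrite -subr_eq0; apply/eqP.
  apply: (uniq0 (fun v => w v - w' v)); first exact: ell2B.
  by apply/funext => x; rewrite adjopB; have := congr1 (@^~ x) e; rewrite /=; lra.
exists B; split.
- split.
  + by move=> f /HB[].
  + move=> a f g hf hg.
    have hfg := ell2_lin a hf hg.
    have [h1 _ e1] := HB _ hf; have [h2 _ e2] := HB _ hg; have [h3 _ e3] := HB _ hfg.
    apply: uniqw => //; first exact: ell2_lin.
    rewrite e3; apply/funext => v; rewrite adjop_lin -{1}e1 -{1}e2; ring.
  + exists 4 => f hf; have [h1 b1 _] := HB _ hf.
    by rewrite !sqnorm2E// -EFinM lee_fin.
- move=> f hf.
  have h1 : ell2 (fun v => A f v - lam * f v).
    by apply: ell2B; [exact: ell2_adjop|exact: ell2Z].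
  by have [h2 _ e2] := HB _ h1; exact: uniqw.
- by move=> f hf; have [] := HB _ hf.
Qed.

(** Let [m] be the supremum of the form over unit vectors; it is enough that [m] lies in the
    spectrum. A bounded inverse of [A - m], combined with [psd_residual_bound], would keep the form
    on unit vectors a fixed distance below [m]. *)
Lemma adjop_form_le f : ell2 f -> ip (A f) f <= sup (spectrum A) * ip f f.
Proof.
pose E := [set r : R | exists g, [/\ ell2 g, ip g g = 1 & r = ip (A g) g]].
have [C C0 HC] := @adjop_bounded R Gam l.
have ubE : has_ubound E.
  exists (C + 1) => _ [g [hg g1 ->]].
  have hA := ell2_adjop l hg.
  have := ip_ge0 (fun v => A g v - g v); rewrite ipB2// g1.
  by have := HC g hg; rewrite g1; lra.
have inE g : ell2 g -> 0 < ip g g -> E (ip (A g) g / ip g g).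
  move=> hg g0; pose c := (Num.sqrt (ip g g))^-1.
  have cc : c * c = (ip g g)^-1 by rewrite /c -invfM -expr2 sqr_sqrtr// ltW.
  exists (fun v => c * g v); split.
  - exact: ell2Z.
  - by rewrite ipZl ipC ipZl mulrA cc mulVf// gt_eqF.
  - by rewrite adjopZ ipZl (ipC _ (fun v => c * _)) ipZl mulrA cc mulrC ipC.
move=> hf; have [f0|f0] := lerP (ip f f) 0.
  have z : f = fun=> 0 by apply/funext => v; apply: ip_eq0.
  have -> : A f = fun=> 0 by rewrite z; apply/funext => v; rewrite /adjop big1.
  have -> : ip f f = 0 by apply/eqP; rewrite eq_le f0 ip_ge0.
  by rewrite ip0l mulr0.
have E0 : E !=set0 by exists (ip (A f) f / ip f f); exact: inE.
have supE : has_sup E by split.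
set m := sup E.
have psd g : ell2 g -> ip (A g) g <= m * ip g g.
  move=> hg; have [g0|g0] := lerP (ip g g) 0.
    have z : g = fun=> 0 by apply/funext => v; apply: ip_eq0.
    have -> : A g = fun=> 0 by rewrite z; apply/funext => v; rewrite /adjop big1.
    have -> : ip g g = 0 by apply/eqP; rewrite eq_le g0 ip_ge0.
    by rewrite ip0l mulr0.
  by rewrite -ler_pdivrMr//; apply: sup_upper_bound => //; exact: inE.
suff msp : spectrum A m.
  apply: le_trans (psd _ hf) _; rewrite ler_pM2r//.
  by apply: sup_upper_bound => //; split; [exists m|exact: spectrum_adjop_bounded].
move=> [B [[Bell _ [D HD]] BT _]].
have [M M0 HM] := psd_residual_bound psd.
(* The bound [D] of the inverse comes without a sign; the maximum with 1 makes [K] positive. *)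
pose K := Num.max D 1 * M.
have K0 : 0 < K by rewrite /K mulr_gt0// lt_max ltr01 orbT.
have low g : ell2 g -> ip g g = 1 -> K^-1 <= m - ip (A g) g.
  move=> hg g1; have hA := ell2_adjop l hg.
  have hmg : ell2 (fun v => m * g v) by exact: ell2Z.
  pose t v := A g v - m * g v.
  have ht : ell2 t by exact: ell2B.
  have tt : ip t t = ip (fun v => m * g v - A g v) (fun v => m * g v - A g v).
    by congr rsum; apply/funext => v; rewrite /t; ring.
  have := HD _ ht; rewrite BT// !sqnorm2E// -EFinM lee_fin g1 => h1.
  have := HM _ hg; rewrite -tt g1 mulr1 => h2.
  rewrite -[K^-1]mulr1 ler_pdivrMl//.
  apply: le_trans h1 _; rewrite /K -mulrA.
  apply: (@le_trans _ _ (Num.max D 1 * ip t t)).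
    by rewrite ler_wpM2r ?ip_ge0// le_max lexx.
  by rewrite ler_pM2l// lt_max ltr01 orbT.
have : m <= m - K^-1.
  apply: ge_sup => // _ [g [hg g1 ->]].
  by have := low _ hg g1; lra.
have : 0 < K^-1 by rewrite invr_gt0.
by lra.
Qed.

End AdjacencySpectrum.

(** * Absence of square summable ground states *)

Section PerronFrobenius.
Context {R : realType} {Gam : groupType}.
Variables (l : seq Gam) (lam : R).
Hypothesis lV : perm_eq [seq (s^-1)%g | s <- l] l.
Hypothesis lgen : generates [set` l].
Hypothesis form_le : forall f : Gam -> R, ell2 f ->
  ip (adjop l f) f <= lam * ip f f.
Implicit Types (f p q : Gam -> R).
Local Notation A := (@adjop R Gam l).

Definition eigenvector f := ell2 f /\ A f = (fun v => lam * f v).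

(** Pointwise [lam |f| <= |A f| <= A |f|], so the form of [lam - A] is at most 0 at [|f|]. It is
    also nonnegative there, and the residual bound turns a vanishing form into a vanishing
    residual. *)
Lemma eigenvector_abs f : eigenvector f -> eigenvector (fun v => `|f v|).
Proof.
move=> [hf Af]; set p := fun v => `|f v|.
have hp : ell2 p by apply: ell2_le hf => v; rewrite normr_id.
split=> //; have hAp := ell2_adjop l hp; have hlp := ell2Z lam hp.
have [M M0 /(_ _ hp) HM] := psd_residual_bound lV form_le.
have le v : lam * p v <= A p v.
  apply: (@le_trans _ _ `|A f v|); last exact: ler_norm_sum.
  by rewrite Af normrM; apply: ler_wpM2r; [exact: normr_ge0|exact: ler_norm].
have : ip (fun v => lam * p v - A p v) (fun v => lam * p v - A p v) <= 0.
  apply: le_trans HM _; rewrite pmulr_rle0// subr_le0 -ipZl.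
  by apply: le_ip_ell2 => // v; exact: normr_ge0.
move=> /(ip_eq0 (ell2B hlp hAp)) e; apply/funext => v.
by have := e v; lra.
Qed.

(** At a zero of [f] the nonnegative values at the neighbors sum to 0, so zeros spread along the
    edges and the generators reach every vertex. *)
Lemma eigenvector_ge0_pos f v : eigenvector f -> (forall w, 0 <= f w) -> f v = 0 ->
  forall w, f w = 0.
Proof.
move=> [_ Af] f0 fv0.
have nb s w : s \in l -> f w = 0 -> f (s * w)%g = 0.
  move=> sl fw; have := congr1 (@^~ w) Af; rewrite /= fw mulr0 => /eqP.
  rewrite psumr_eq0; last by move=> *; exact: f0.
  by move=> /allP/(_ _ sl)/= /eqP.
(* [H] is the stabilizer of the zero set under left translation; an equivalence, unlike an
   implication, is visibly closed under inversion. *)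
pose H := [set g | forall w, f w = 0 <-> f (g * w)%g = 0].
have HT : H = setT.
  apply: lgen.
  - move=> s /= sl w; split; first exact: nb.
    move=> h; rewrite -(mulKg s w); apply: nb => //.
    by have := map_f (fun s => s^-1)%g sl; rewrite (perm_mem lV).
  - by move=> w; rewrite mul1g.
  - by move=> x y Hx Hy w; rewrite -mulgA; exact: (iff_trans (Hy w) (Hx _)).
  - by move=> x Hx w; have := Hx (x^-1 * w)%g; rewrite mulVKg => -[? ?]; split.
move=> w; have : H (w * v^-1)%g by rewrite HT.
by move=> /(_ v) [/(_ fv0)]; rewrite mulgVK.
Qed.

Lemma eigenvector_rmul f x : eigenvector f -> eigenvector (fun v => f (v * x)%g).
Proof.
by move=> [hf Af]; split; [exact: ell2_rmul|rewrite adjop_rmul Af].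
Qed.

Lemma eigenvector_lin (a : R) f g : eigenvector f -> eigenvector g ->
  eigenvector (fun v => a * f v + g v).
Proof.
move=> [hf Af] [hg Ag]; split; first exact: ell2_lin.
by rewrite adjop_lin Af Ag; apply/funext => v; ring.
Qed.

(** The nonnegative eigenvector [q + |q|] vanishes wherever [q] is negative, hence everywhere as
    soon as [q] is negative once. *)
Lemma eigenvector_pm q : eigenvector q ->
  (forall v, 0 <= q v) \/ (forall v, q v <= 0).
Proof.
move=> hq; have ha := eigenvector_abs hq.
have hp := eigenvector_lin 1 hq ha.
have hn := eigenvector_lin (-1) hq ha.
have [|/existsNP[v /negP]] := pselect (forall v, 0 <= q v); first by left.
rewrite -ltNge => qv; right => w.
have : 1 * q w + `|q w| = 0.
  apply: (eigenvector_ge0_pos (v := v) hp).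
    by move=> x; have := ler_norm (- q x); rewrite normrN; lra.
  by rewrite ltr0_norm//; ring.
by have := normr_ge0 (q w); lra.
Qed.

(** For [p = |f|], the difference between [p] and a right translate has constant sign, while both
    have the same l2 norm. So [p] is constant, and a square summable constant on an infinite set is
    0. *)
Lemma no_ell2_eigenvector f : infinite_set [set: Gam] -> eigenvector f ->
  forall v, f v = 0.
Proof.
move=> inf /eigenvector_abs hf; set p := fun v => `|f v| in hf.
have p_inv x v : p (v * x)%g = p v.
  have hpx := eigenvector_rmul x hf.
  have [[hp _] [hpx' _]] := (hf, hpx).
  have := eigenvector_pm (eigenvector_lin (-1) hf hpx).
  have p0 w : 0 <= p w by exact: normr_ge0.
  (* [D] has constant sign and total sum 0, so each of its terms vanishes. *)
  pose D w := p (w * x)%g * p (w * x)%g - p w * p w.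
  have hD : asum D by apply: asumB; exact: asumM.
  have D0 : rsum D = 0.
    rewrite rsumB; [|exact: asumM|exact: asumM].
    by rewrite -[X in X - _]/(ip _ _) (ip_bij p p (mulgK x) (mulgVK x)) subrr.
  move=> [sgn|sgn].
  - have Dv : D v <= 0.
      rewrite -D0; apply: rsum_term => // w; rewrite /D.
      by have := sgn w; have := p0 w; have := p0 (w * x)%g; nra.
    apply/eqP; rewrite eq_le; apply/andP; split; last by have := sgn v; lra.
    by move: Dv; rewrite /D; have := p0 v; have := p0 (v * x)%g; nra.
  - have Dv : - D v <= 0.
      rewrite -oppr0 -D0 -rsumN;
      apply: (rsum_term (f := fun w => - D w)) => [w|]; last exact: asumN.
      by rewrite /D; have := sgn w; have := p0 w; have := p0 (w * x)%g; nra.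
    apply/eqP; rewrite eq_le; apply/andP; split; first by have := sgn v; lra.
    by move: Dv; rewrite /D; have := p0 v; have := p0 (v * x)%g; nra.
move=> v; apply/eqP; rewrite -normr_eq0; apply/eqP; rewrite -/(p v).
have [//|pv] := eqVneq (p v) 0.
have [hp _] := hf.
have p2 : 0 < p v ^+ 2 by rewrite exprn_gt0// lt_def pv normr_ge0.
have pc w : p w = p v by rewrite -(p_inv (v^-1 * w)%g v) mulVKg.
(* Chosen so that [n] copies of [p v ^+ 2] exceed the squared norm of [p]. *)
pose n := (Num.Def.trunc (ip p p / p v ^+ 2)).+1.
have [B BT] := infinite_set_fset n inf.
move=> Bn; have : \sum_(w <- finmap.enum_fset B) p w * p w <= ip p p.
  apply: rsum_seq; last exact: finmap.fset_uniq; last exact: asumM.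
  by move=> w; rewrite -expr2 sqr_ge0.
rewrite (eq_bigr (fun=> p v ^+ 2)); last by move=> w _; rewrite pc expr2.
rewrite big_const_seq count_predT iter_addr_0 -mulr_natl -ler_pdivlMr//.
rewrite leNgt => /negP[]; apply: (@lt_le_trans _ _ n%:R); last by rewrite ler_nat.
by rewrite /n; apply: truncnS_gt.
Qed.

End PerronFrobenius.

(** * Adjacency in a Cayley graph and its top eigenvalue *)

Section CayleyAdjacency.
Context {R : realType} {Gam : groupType}.
Variable S : set Gam.
Hypothesis S_finite : finite_set S.
Hypothesis S_symmetric : symmetric_set S.
Hypothesis S_generates : generates S.
Local Notation l := (finmap.enum_fset (fset_set S)).

Lemma mem_enumS s : (s \in l) = (s \in S).
Proof. by rewrite -(in_fset_set S_finite). Qed.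

Lemma sum_neighbors (f : Gam -> R) v :
  \sum_(u \in neighbors (cayley S) v) f u = adjop l f v.
Proof.
have -> : neighbors (cayley S) v = [set (s * v)%g | s in S].
  by apply/seteqP; split => u /= [s Ss e]; exists s.
rewrite fsbig_image; first by rewrite fsbig_finite.
by move=> x y _ _ /mulIg.
Qed.

Lemma enumSV : perm_eq [seq (s^-1)%g | s <- l] l.
Proof.
apply: uniq_perm; [|exact: finmap.fset_uniq|].
  by rewrite map_inj_uniq ?finmap.fset_uniq//; exact: invg_inj.
move=> s; apply/mapP/idP => [[t]|].
  by rewrite !mem_enumS => tS ->; rewrite inE; apply: S_symmetric; rewrite inE in tS.
rewrite mem_enumS inE => Ss; exists (s^-1)%g; last by rewrite invgK.
by rewrite mem_enumS inE; exact: S_symmetric.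
Qed.

Lemma enumS_generates : generates [set` l].
Proof.
move=> H lH; apply: S_generates => s Ss; apply: lH => /=.
by rewrite mem_enumS inE.
Qed.

Lemma lambda_max_not_ell2_eigenvalue (f : Gam -> R) : infinite_set [set: Gam] ->
  ell2 f ->
  (forall v, adjop l f v = lambda_max R (cayley S) * f v) ->
  forall v, f v = 0.
Proof.
move=> inf hf Af.
have eA : lambda_max R (cayley S) = sup (spectrum (@adjop R Gam l)).
  congr (sup (spectrum _)).
  by apply/funext => g; apply/funext => v; exact: sum_neighbors.
apply: (no_ell2_eigenvector (lam := lambda_max R (cayley S)) enumSV enumS_generates _ inf).
  by move=> g hg; rewrite eA; exact: (adjop_form_le enumSV).
by split=> //; apply/funext.
Qed.

End CayleyAdjacency.

(** * Second moment of the normal distribution *)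

Section NormalSecondMoment.
Context {R : realType}.
Local Notation mu := (@lebesgue_measure R).

(** Doubling the deviation absorbs the factor [x^2]: with [y = 3 x^2 / (8 s^2)] the exponent splits
    as [x^2 / (2 s^2) = y + x^2 / (2 (2 s)^2)], and [y exp(-y) <= 1]. The second moment is then
    controlled by the total mass of a normal density. *)
Lemma sqr_normal_pdf_le (s x : R) : s != 0 ->
  x ^+ 2 * normal_pdf 0 s x <=
  (8 / 3 * s ^+ 2 * normal_peak s / normal_peak (2 * s)) * normal_pdf 0 (2 * s) x.
Proof.
move=> s0; have s20 : 2 * s != 0 by rewrite mulf_neq0.
have P0 := normal_peak_gt0 s20.
have pE t : t != 0 -> normal_pdf 0 t x = normal_peak t * normal_fun 0 t x.
  by move=> t0; rewrite normal_pdfE.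
rewrite !pE// [leRHS]mulrA divfK ?gt_eqF// mulrCA (mulrC _ (normal_peak s)) -[leRHS]mulrA.
rewrite ler_wpM2l ?normal_peak_ge0// /normal_fun !subr0.
have -> : - x ^+ 2 / (s ^+ 2 *+ 2) =
    - (3 / 8 * x ^+ 2 / s ^+ 2) + - x ^+ 2 / ((2 * s) ^+ 2 *+ 2).
  by field.
rewrite expRD mulrA ler_wpM2r ?expR_ge0//.
set y := 3 / 8 * x ^+ 2 / s ^+ 2.
have -> : x ^+ 2 = 8 / 3 * s ^+ 2 * y by rewrite /y; field.
have le1 : y * expR (- y) <= 1.
  by rewrite expRN ler_pdivrMr ?expR_gt0// mul1r; have := expR_ge1Dx y; lra.
have K0 : 0 <= 8 / 3 * s ^+ 2 by rewrite mulr_ge0 ?sqr_ge0//; lra.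
by have := ler_wpM2l K0 le1; rewrite mulr1 mulrA.
Qed.

(** The Radon-Nikodym derivative of the normal law and [normal_pdf] have the same integral over
    every measurable set, hence agree almost everywhere. *)
Lemma ge0_integral_normal_prob (s : R) (f : R -> \bar R) :
  (forall x, (0 <= f x)%E) -> measurable_fun setT f ->
  (\int[normal_prob 0%R s]_x f x = \int[mu]_x (f x * (normal_pdf 0 s x)%:E))%E.
Proof.
move=> f0 mf; have dom := @normal_prob_dominates R 0 s.
rewrite -(Radon_Nikodym_SigmaFinite.change_of_variables dom)//.
have mp : measurable_fun setT (fun x => (normal_pdf 0 s x)%:E).
  by apply/measurable_EFinP; exact: measurable_normal_pdf.
have iRN := Radon_Nikodym_SigmaFinite.f_integrable dom.
apply: ae_eq_integral => //.
- by apply: emeasurable_funM => //; exact: measurable_int iRN.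
- exact: emeasurable_funM.
- apply: ae_eqe_mul2l; apply: integral_ae_eq => //.
  by move=> E E01 mE; rewrite -Radon_Nikodym_SigmaFinite.f_integral.
Qed.

Lemma normal_prob_second_moment (s : R) : s != 0 ->
  (\int[normal_prob 0%R s]_x (x ^+ 2)%:E < +oo)%E.
Proof.
move=> s0; rewrite ge0_integral_normal_prob; last 2 first.
- by move=> x; rewrite lee_fin sqr_ge0.
- by apply/measurable_EFinP; exact: measurable_funX.
pose C := 8 / 3 * s ^+ 2 * normal_peak s / normal_peak (2 * s).
have C0 : 0 <= C.
  rewrite /C divr_ge0 ?normal_peak_ge0// mulr_ge0 ?normal_peak_ge0//.
  by rewrite mulr_ge0 ?sqr_ge0//; lra.
apply: (@le_lt_trans _ _ (\int[mu]_x (C%:E * (normal_pdf 0 (2 * s) x)%:E))%E).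
  apply: ge0_le_integral => //.
  - move=> x _; rewrite -EFinM lee_fin; apply: mulr_ge0; first exact: sqr_ge0.
    exact: normal_pdf_ge0.
  - apply/measurable_EFinP; apply: measurable_funM; last exact: measurable_normal_pdf.
    exact: measurable_funX.
  - apply/measurable_EFinP; apply: measurable_funM; last exact: measurable_normal_pdf.
    exact: measurable_cst.
  - by move=> x _; rewrite -!EFinM lee_fin; exact: sqr_normal_pdf_le.
rewrite ge0_integralZl//.
- by rewrite integral_normal_pdf mule1 ltry.
- by apply/measurable_EFinP; exact: measurable_normal_pdf.
- by move=> x _; rewrite lee_fin normal_pdf_ge0.
Qed.

End NormalSecondMoment.

(** * The Borel sigma-algebra of a countable product *)

Section ProductSigmaAlgebra.
Context {R : realType} {V : choiceType}.
Local Notation Om := (Omega R V).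

(** The supersets of the finite-coordinate neighborhoods of [w] form a filter that converges to [w]
    in each coordinate, hence in the product topology. *)
Lemma ptws_open_basis (O : set {ptws V -> R}) (w : V -> R) : open O -> O w ->
  exists s : seq V, exists2 e : R, 0 < e &
    forall w', (forall v, v \in s -> `|w' v - w v| < e) -> O w'.
Proof.
move=> oO Ow.
pose F : set_system {ptws V -> R} := [set A | exists s : seq V, exists2 e : R, 0 < e &
  forall w', (forall v, v \in s -> `|w' v - w v| < e) -> A w'].
have FF : Filter F.
  split.
  - by exists [::], 1.
  - move=> A B [s [e e0 sA]] [t [e' e'0 tB]]; exists (s ++ t), (Num.min e e').
      by rewrite lt_min e0.
    move=> w' h; split; [apply: sA|apply: tB] => v vs.
      by apply: lt_le_trans (h v _) _; rewrite ?mem_cat ?vs// ge_min lexx.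
    by apply: lt_le_trans (h v _) _; rewrite ?mem_cat ?vs ?orbT// ge_min lexx orbT.
  - by move=> A B AB [s [e e0 sA]]; exists s, e => // w' /sA/AB.
have : F --> (w : {ptws V -> R}).
  apply/cvg_sup => v; apply/cvg_image.
    rewrite eqEsubset; split => y //= _; exists (fun=> y) => //.
  move=> N /nbhs_ballP[e /= e0 eN]; exists ((fun f : V -> R => f v) @^-1` N).
    exists [:: v], e => // w' h; apply: eN.
    by rewrite /ball /= distrC; apply: h; rewrite mem_head.
  rewrite eqEsubset; split => [_ [f fN <-]//|y Ny].
  by exists (fun=> y).
by apply; exact: open_nbhs_nbhs.
Qed.

Definition box (s : seq V) (B : V -> set R) : set Om :=
  [set w | forall v, v \in s -> B v (w v)].

Definition boxes : set (set Om) :=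
  [set C | exists s B, (forall v, measurable (B v)) /\ C = box s B].

Lemma box_undup s B : box (undup s) B = box s B.
Proof. by apply/seteqP; split => w h v vs; apply: h; rewrite ?mem_undup// -mem_undup. Qed.

Lemma boxesI : setI_closed boxes.
Proof.
move=> _ _ [s [B [mB ->]]] [t [C [mC ->]]].
exists (s ++ t), (fun v =>
  (if v \in s then B v else setT) `&` (if v \in t then C v else setT)).
split; first by move=> v; apply: measurableI; case: ifP.
apply/seteqP; split => w.
  move=> [hs ht] v _; split; case: ifP => // vs; by [exact: hs|exact: ht].
move=> h; split=> v vs.
  have vst : v \in s ++ t by rewrite mem_cat vs.
  by have [+ _] := h v vst; rewrite vs.
have vst : v \in s ++ t by rewrite mem_cat vs orbT.
by have [_] := h v vst; rewrite vs.
Qed.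

Lemma boxes_setT : boxes setT.
Proof. by exists [::], (fun=> setT); split=> //; apply/seteqP; split. Qed.

Lemma measurable_coord v : measurable_fun [set: Om] (fun w : Om => w v).
Proof.
apply: (measurability _ (RGenOInfty.measurableE R)) => _ [_ [a ->] <-].
rewrite setTI; apply: sub_sigma_algebra.
apply: (@open_comp {ptws V -> R} R (fun w => w v)).
  by move=> w _; exact: (@proj_continuous V (fun=> R) v).
exact: itv_open_ends_open.
Qed.

Lemma measurable_box s B : (forall v, measurable (B v)) -> measurable (box s B).
Proof.
move=> mB; elim: s => [|v s IH].
  by rewrite (_ : box _ _ = setT)//; apply/seteqP; split.
rewrite (_ : box _ _ = (fun w : Om => w v) @^-1` B v `&` box s B).
  apply: measurableI => //; rewrite -[X in measurable X]setTI.
  exact: measurable_coord.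
apply/seteqP; split => w.
  by move=> h; split => [|u us]; apply: h; rewrite inE ?eqxx// us orbT.
by move=> [h1 h2] u; rewrite inE => /orP[/eqP->//|]; exact: h2.
Qed.

Section Countable.
Variable e : nat -> V.
Hypothesis e_surj : forall v, exists n, e n = v.

(** Boxes with rational centers and one rational radius, coordinates being named by their position
    in [e]; the index type is countable. *)
Let cbox (i : seq (nat * rat) * rat) : set Om :=
  [set w | forall p, p \in i.1 -> `|w (e p.1) - ratr p.2| < ratr i.2].

Let cbox_boxes i : <<s boxes >> (cbox i).
Proof.
case: i => l r; elim: l => [|p l IH].
  rewrite (_ : cbox _ = setT); first by apply: sub_sigma_algebra; exact: boxes_setT.
  by apply/seteqP; split.
pose B : set R := ball (ratr p.2 : R) (ratr r : R).
rewrite (_ : cbox _ = box [:: e p.1] (fun=> B) `&` cbox (l, r)); last first.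
  apply/seteqP; split => w.
    move=> h; split => [v|q ql]; last by apply: h; rewrite inE ql orbT.
    by rewrite inE => /eqP ->; rewrite /B /ball/= distrC; apply: h; rewrite mem_head.
  move=> [h1 h2] q; rewrite inE => /orP[/eqP->|]; last exact: h2.
  by rewrite distrC; apply: h1; rewrite mem_head.
apply: (@measurableI _ (g_sigma_algebraType boxes)) => //.
apply: sub_sigma_algebra; exists [:: e p.1], (fun=> B); split=> // _.
exact: measurable_ball.
Qed.

(** For a countable index set, an open set is the union of the countably many rational boxes that it
    contains. *)
Lemma Omega_measurableE : @measurable _ Om = <<s boxes >>.
Proof.
apply/seteqP; split; last first.
  apply: smallest_sub; first exact: sigma_algebra_measurable.
  by move=> _ [s [B [mB ->]]]; exact: measurable_box.
apply: smallest_sub; first exact: smallest_sigma_algebra.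
move=> O oO.
have -> : O = \bigcup_i (if pselect (cbox i `<=` O) then cbox i else set0).
  apply/seteqP; split => w; last first.
    by move=> [i _]; case: pselect => // iO; exact: iO.
  move=> Ow; have [s [d d0 sO]] := ptws_open_basis oO Ow.
  (* The radius [r] stays below [d / 2], leaving room for the distance from [w] to the rational
     center. *)
  have d20 : 0 < d / 2 by lra.
  have [r /[!in_itv]/= /andP[r0 rd]] := rat_in_itvoo d20.
  have /choice[q hq] : forall v, exists q : rat, `|w v - ratr q| < ratr r.
    move=> v.
    have h : w v - ratr r < w v + ratr r by lra.
    have [q /[!in_itv]/= /andP[q1 q2]] := rat_in_itvoo h.
    by exists q; rewrite ltr_norml; apply/andP; split; lra.
  have [n hn] := choice e_surj.
  pose i := ([seq (n v, q v) | v <- s], r).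
  have iO : cbox i `<=` O.
    move=> w' h; apply: sO => v vs.
    have := h (n v, q v); rewrite map_f// => /(_ isT)/=; rewrite hn => h1.
    have h2 := hq v; rewrite distrC in h2.
    rewrite (_ : w' v - w v = (w' v - ratr (q v)) + (ratr (q v) - w v)); last by ring.
    by apply: le_lt_trans (ler_normD _ _) _; lra.
  have cw : cbox i w.
    rewrite /cbox /= => _ /mapP[v vs ->] /=.
    by rewrite hn; exact: hq.
  by exists i => //; case: pselect.
apply: (@countable_bigcupT_measurable _ (g_sigma_algebraType boxes)) => // i.
by case: pselect => iO /=; [exact: (cbox_boxes i)|exact: measurable0].
Qed.

Lemma measurable_to_Omega d (T : measurableType d) (h : T -> Om) :
  (forall v, measurable_fun setT (fun t => h t v)) -> measurable_fun setT h.
Proof.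
move=> mh; apply: (measurability _ Omega_measurableE) => _ [_ [s [B [mB ->]]] <-].
rewrite setTI; elim: s => [|v s IH].
  by rewrite (_ : _ @^-1` _ = setT)//; apply/seteqP; split.
rewrite (_ : h @^-1` _ = (fun t => h t v) @^-1` B v `&` h @^-1` box s B).
  by apply: measurableI => //; rewrite -[X in measurable X]setTI; exact: mh.
apply/seteqP; split => w.
  by move=> hw; split => [|u us]; apply: hw; rewrite inE ?eqxx// us orbT.
by move=> [h1 h2] u; rewrite inE => /orP[/eqP->//|]; exact: h2.
Qed.

End Countable.
End ProductSigmaAlgebra.

(** * Almost orthogonal families *)

Section SquareIntegrable.
Context {d} {T : measurableType d} {R : realType} (mu : probability T R).
Implicit Types (f g h : T -> R).

Definition sqint f := measurable_fun [set: T] f /\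
  mu.-integrable [set: T] (EFin \o (fun x => f x * f x)).

Definition dot f g : R := \int[mu]_x (f x * g x).

Lemma sqintM f g : sqint f -> sqint g ->
  mu.-integrable [set: T] (EFin \o (fun x => f x * g x)).
Proof.
move=> [mf If] [mg Ig].
apply: (le_integrable measurableT _ _ (integrableD measurableT If Ig)).
  by apply/measurable_EFinP; exact: measurable_funM.
move=> x _ /=; rewrite lee_fin [leRHS]ger0_norm ?addr_ge0// -?expr2 ?sqr_ge0//.
by rewrite ler_norml; apply/andP; split; nra.
Qed.

Lemma sqint_lin (a : R) f g : sqint f -> sqint g -> sqint (fun x => a * f x + g x).
Proof.
move=> hf hg; split.
  by apply: measurable_funD; [apply: measurable_funM => //; exact: hf.1|exact: hg.1].
rewrite (_ : EFin \o _ = (fun x => (a ^+ 2)%:E * (EFin \o (fun x => (f x * f x)%R)) x)%E \+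
  ((fun x => (2 * a)%:E * (EFin \o (fun x => (f x * g x)%R)) x)%E \+
   (EFin \o (fun x => (g x * g x)%R)))%E)%E.
  apply: integrableD => //; first by apply: integrableZl => //; exact: sqintM.
  apply: integrableD => //; last exact: sqintM.
  by apply: integrableZl => //; exact: sqintM.
by apply/funext => x /=; rewrite -!EFinM -!EFinD; congr EFin; ring.
Qed.

Lemma sqint_cst (c : R) : sqint (fun=> c).
Proof. by split => //; exact: finite_measure_integrable_cst. Qed.

Lemma sqintZ (a : R) f : sqint f -> sqint (fun x => a * f x).
Proof.
move=> hf; have := sqint_lin a hf (sqint_cst 0).
by under eq_fun do rewrite addr0.
Qed.

Lemma sqint_indic (A : set T) : measurable A -> sqint \1_A.
Proof.
move=> mA; split; first exact: measurable_indic.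
rewrite (_ : EFin \o _ = fun x => (\1_A x)%:E); first exact: integrable_indic.
by apply/funext => x /=; rewrite !indicE; case: (_ \in _); rewrite ?mulr1 ?mulr0.
Qed.

Lemma dotC f g : dot f g = dot g f.
Proof. by apply: eq_Rintegral => x _; rewrite mulrC. Qed.

Lemma dot_lin (a : R) f g h : sqint f -> sqint g -> sqint h ->
  dot (fun x => a * f x + g x) h = a * dot f h + dot g h.
Proof.
move=> hf hg hh; rewrite /dot -RintegralZl//; last exact: sqintM.
rewrite -RintegralD//; last exact: sqintM.
  by apply: eq_Rintegral => x _; ring.
rewrite (_ : EFin \o _ = fun x => a%:E * (EFin \o (fun x => f x * h x)%R) x)%E.
  by apply: integrableZl => //; exact: sqintM.
by apply/funext => x /=; rewrite -EFinM.
Qed.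

Lemma dot0l h : dot (fun=> 0) h = 0.
Proof.
rewrite /dot (_ : (fun x => 0 * h x) = fun=> 0); last first.
  by apply/funext => x; rewrite mul0r.
by rewrite Rintegral_cst// mul0r.
Qed.

Lemma sqint_sum (I : Type) (s : seq I) (a : I -> R) (phi : I -> T -> R) :
  (forall i, sqint (phi i)) -> sqint (fun x => \sum_(i <- s) a i * phi i x).
Proof.
move=> hphi; elim: s => [|i s IH].
  by under eq_fun do rewrite big_nil; exact: sqint_cst.
by under eq_fun do rewrite big_cons; exact: sqint_lin.
Qed.

Lemma dot_suml (I : Type) (s : seq I) (a : I -> R) (phi : I -> T -> R) h :
  (forall i, sqint (phi i)) -> sqint h ->
  dot (fun x => \sum_(i <- s) a i * phi i x) h = \sum_(i <- s) a i * dot (phi i) h.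
Proof.
move=> hphi hh; elim: s => [|i s IH].
  by under eq_fun do rewrite big_nil; rewrite dot0l big_nil.
under eq_fun do rewrite big_cons.
by rewrite dot_lin// ?IH ?big_cons//; exact: sqint_sum.
Qed.

Lemma dot_ge0 f : 0 <= dot f f.
Proof. by apply: Rintegral_ge0 => x _; rewrite -expr2 sqr_ge0. Qed.

(* Schur test on the Gram matrix, followed by Bessel's argument. *)
Lemma almost_orthogonal_bessel (I : eqType) (s : seq I) (phi : I -> T -> R) f (D : R) :
  (forall i, sqint (phi i)) -> sqint f -> 0 < D ->
  (forall i, i \in s -> \sum_(j <- s) `|dot (phi i) (phi j)| <= D) ->
  \sum_(i <- s) dot f (phi i) ^+ 2 <= D * dot f f.
Proof.
move=> hphi hf D0 HD; pose a i := dot f (phi i).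
pose G i j := dot (phi i) (phi j).
pose psi x := \sum_(i <- s) a i * phi i x.
have hpsi : sqint psi by exact: sqint_sum.
have fpsi : dot f psi = \sum_(i <- s) a i ^+ 2.
  by rewrite dotC dot_suml//; apply: eq_bigr => i _; rewrite dotC expr2.
have psipsi : dot psi psi = \sum_(i <- s) \sum_(j <- s) a i * a j * G i j.
  rewrite dot_suml//; apply: eq_bigr => i _.
  rewrite dotC dot_suml// mulr_sumr; apply: eq_bigr => j _.
  by rewrite mulrA dotC.
have Gsym i j : G i j = G j i by exact: dotC.
have schur : dot psi psi <= D * \sum_(i <- s) a i ^+ 2.
  have E : \sum_(i <- s) \sum_(j <- s) a i ^+ 2 * `|G i j| <= D * \sum_(i <- s) a i ^+ 2.
    rewrite mulr_sumr big_seq [leRHS]big_seq; apply: ler_sum => i si.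
    by rewrite -mulr_sumr mulrC ler_wpM2r ?sqr_ge0// HD.
  rewrite psipsi; apply: le_trans E.
  (* Since [G] is symmetric, [a i ^+ 2] may be averaged with [a j ^+ 2], and the average dominates
     [a i * a j]. *)
  have -> : \sum_(i <- s) \sum_(j <- s) a i ^+ 2 * `|G i j| =
      \sum_(i <- s) \sum_(j <- s) (a i ^+ 2 + a j ^+ 2) / 2 * `|G i j|.
    set X := LHS.
    have XE : X = \sum_(i <- s) \sum_(j <- s) a j ^+ 2 * `|G i j|.
      by rewrite /X exchange_big; apply: eq_bigr => i _;
        apply: eq_bigr => j _; rewrite Gsym.
    have -> : X = X / 2 + X / 2 by lra.
    rewrite {2}XE /X !mulr_suml -big_split; apply: eq_bigr => i _ /=.
    by rewrite !mulr_suml -big_split; apply: eq_bigr => j _ /=; ring.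
  apply: ler_sum => i _; apply: ler_sum => j _.
  apply: le_trans (ler_norm _) _; rewrite normrM ler_wpM2r//.
  move: (a i) (a j) => x y.
  by have := sqr_ge0 (x - y); have := sqr_ge0 (x + y); rewrite ler_norml; nra.
(* Expanding [|psi - D f|^2 >= 0] gives [2 D A <= D^2 |f|^2 + |psi|^2], with [A] the sum of the
   squared coefficients, and [schur] bounds [|psi|^2] by [D A]. *)
have := dot_ge0 (fun x => - D * f x + psi x).
have hh := sqint_lin (- D) hf hpsi.
rewrite dot_lin// (dotC f) (dotC psi) !dot_lin// (dotC psi f) fpsi => H.
set A := \sum_(i <- s) a i ^+ 2 in fpsi schur H.
have : D * A <= D * (D * dot f f) by nra.
by rewrite ler_pM2l.
Qed.

End SquareIntegrable.

(** * Translations of a product measure *)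

Section ShiftOfProductMeasure.
Context {R : realType} {Gam : groupType}.
Variable e : nat -> Gam.
Hypothesis e_surj : forall v, exists n, e n = v.
Variable mu : probability (Omega R Gam) R.
Variable gamma : set R -> \bar R.
Hypothesis mu_box : forall (s : seq Gam) (B : Gam -> set R), uniq s ->
  (forall v, measurable (B v)) -> mu (box s B) = (\prod_(v <- s) gamma (B v))%E.
Local Notation Om := (Omega R Gam).

(** Right translation commutes with the left multiplications that define the edges of a Cayley
    graph. *)
Definition shift (x : Gam) (w : Om) : Om := fun v => w (v * x)%g.

Lemma shiftK x : cancel (shift x) (shift x^-1%g).
Proof. by move=> w; apply/funext => v; rewrite /shift mulgVK. Qed.

Lemma measurable_shift x : measurable_fun [set: Om] (shift x).
Proof. by apply: (measurable_to_Omega e_surj) => v; exact: measurable_coord. Qed.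

Definition shift_seq (x : Gam) (s : seq Gam) := [seq (v * x)%g | v <- s].
Definition shift_sets (x : Gam) (B : Gam -> set R) u := B (u * x^-1)%g.

Lemma shift_box x s B :
  shift x @^-1` box s B = box (shift_seq x s) (shift_sets x B).
Proof.
apply/seteqP; split => w h v.
  by move=> /mapP[u us ->]; rewrite /shift_sets mulgK; exact: h.
move=> vs; have := h (v * x)%g; rewrite /shift_sets mulgK; apply.
by apply/mapP; exists v.
Qed.

Lemma uniq_shift_seq x s : uniq s -> uniq (shift_seq x s).
Proof. by move=> us; rewrite map_inj_uniq//; exact: mulIg. Qed.

Lemma mu_shift_box x s B : uniq s -> (forall v, measurable (B v)) ->
  mu (shift x @^-1` box s B) = mu (box s B).
Proof.
move=> us mB; rewrite shift_box !mu_box ?uniq_shift_seq//.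
  by rewrite big_map; apply: eq_bigr => v _; rewrite /shift_sets mulgK.
by move=> v; exact: mB.
Qed.

(** Both sides are probability measures that agree on the boxes, an intersection-stable family
    generating the sigma-algebra. *)
Lemma mu_shift x (A : set Om) : measurable A -> mu (shift x @^-1` A) = mu A.
Proof.
move=> mA; have mS := measurable_shift x.
apply: (measure_unique boxes (fun=> setT) _ _ _ _ (pushforward mu (shift x)) mu) => //.
- exact: (Omega_measurableE e_surj).
- exact: boxesI.
- by move=> _; exact: boxes_setT.
- by rewrite bigcup_const.
- move=> _ [s [B [mB ->]]]; rewrite -box_undup.
  by apply: mu_shift_box => //; exact: undup_uniq.
- by move=> _; rewrite /= /pushforward /= preimage_setT probability_setT ltry.
Qed.

Lemma integrable_shift x (f : Om -> R) : measurable_fun [set: Om] f ->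
  mu.-integrable [set: Om] (EFin \o f) ->
  mu.-integrable [set: Om] (EFin \o (f \o shift x)).
Proof.
move=> mf /integrableP[_ If]; have mS := measurable_shift x.
apply/integrableP; split.
  by apply/measurable_EFinP; exact: measurableT_comp.
have mf' : measurable_fun [set: Om] (fun w => `|(EFin \o f) w|%E).
  by apply: measurableT_comp => //; exact/measurable_EFinP.
rewrite [ltLHS](_ : _ = \int[mu]_w ((fun w => `|(EFin \o f) w|%E) \o shift x) w)%E//.
rewrite -[X in (\int[_]_(_ in X) _)%E](preimage_setT (shift x)).
rewrite -ge0_integral_pushforward//.
rewrite (eq_measure_integral mu)// => A mA _; exact: mu_shift.
Qed.

Lemma Rintegral_shift x (f : Om -> R) : measurable_fun [set: Om] f ->
  mu.-integrable [set: Om] (EFin \o f) ->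
  \int[mu]_w f (shift x w) = \int[mu]_w f w.
Proof.
move=> mf If; have mS := measurable_shift x; rewrite /Rintegral; congr fine.
rewrite [LHS](_ : _ = \int[mu]_(w in shift x @^-1` setT) ((EFin \o f) \o shift x) w)%E//.
rewrite -(integral_pushforward mS)//; last 2 first.
- exact/measurable_EFinP.
- by rewrite preimage_setT; exact: integrable_shift.
by apply: eq_measure_integral => A mA _; exact: mu_shift.
Qed.

(** Written as a linear combination of two indicators so that [sqint_lin] and [dot_lin] apply
    directly. *)
Definition centred (C : set Om) (w : Om) : R := - fine (mu C) * \1_setT w + \1_C w.

Lemma sqint_centred C : measurable C -> sqint mu (centred C).
Proof. by move=> mC; apply: sqint_lin; exact: sqint_indic. Qed.

Lemma dot_indic (C D : set Om) : measurable C -> measurable D ->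
  dot mu \1_C \1_D = fine (mu (C `&` D)).
Proof.
move=> mC mD; rewrite /dot /Rintegral; congr fine.
rewrite -[in RHS](setIT (C `&` D)) -integral_indic//; last exact: measurableI.
by apply: eq_integral => w _; rewrite indicI.
Qed.

Lemma dot_centred (C D : set Om) : measurable C -> measurable D ->
  dot mu (centred C) (centred D) = fine (mu (C `&` D)) - fine (mu C) * fine (mu D).
Proof.
move=> mC mD; have hT := sqint_indic mu (@measurableT _ Om).
have hC := sqint_indic mu mC; have hD := sqint_indic mu mD.
rewrite /centred dot_lin//; last exact: sqint_lin.
rewrite (dotC _ _ (fun w => _ * \1_setT w + \1_D w)) (dotC _ \1_C).
rewrite !dot_lin// !dot_indic// !setIT !setTI probability_setT /= (setIC D C).
by ring.
Qed.

Lemma norm_dot_centred_le1 (C D : set Om) : measurable C -> measurable D ->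
  `|dot mu (centred C) (centred D)| <= 1.
Proof.
move=> mC mD; rewrite dot_centred//.
have b (A : set Om) : measurable A -> 0 <= fine (mu A) <= 1.
  move=> mA; rewrite fine_ge0//= -lee_fin fineK ?fin_num_measure//.
  exact: probability_le1.
have /andP[c0 c1] := b _ mC; have /andP[d0 d1] := b _ mD.
have /andP[i0 i1] := b _ (measurableI _ _ mC mD).
by rewrite ler_norml; apply/andP; split; nra.
Qed.

Lemma box_cat s t B C : (forall v, v \in s -> v \notin t) ->
  box s B `&` box t C = box (s ++ t) (fun v => if v \in s then B v else C v) :> set Om.
Proof.
move=> st; apply/seteqP; split => w.
  move=> [hs ht] v; rewrite mem_cat; case: ifP => vs /=; first by move=> _; exact: hs.
  exact: ht.
move=> h; split => v vs.
  by have := h v; rewrite mem_cat vs; exact.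
have := h v; rewrite mem_cat vs orbT => /(_ isT).
by case: ifP => // /st; rewrite vs.
Qed.

(** Boxes over disjoint coordinate sets are independent events, so their covariance is 0. *)
Lemma dot_centred_box_disjoint s t B C : uniq s -> uniq t ->
  (forall v, measurable (B v)) -> (forall v, measurable (C v)) ->
  (forall v, v \in s -> v \notin t) ->
  dot mu (centred (box s B)) (centred (box t C)) = 0.
Proof.
move=> us ut mB mC st.
have mbB := measurable_box s mB; have mbC := measurable_box t mC.
rewrite dot_centred// -fineM ?fin_num_measure//; apply/eqP; rewrite subr_eq0; apply/eqP.
congr fine; rewrite box_cat// mu_box; last 2 first.
- rewrite cat_uniq us ut andbT; apply/hasPn => v vt.
  by apply/negP => /st; rewrite vt.
- by move=> v; case: ifP.
rewrite big_cat /= !mu_box//; congr (_ * _)%E; rewrite big_seq [RHS]big_seq.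
  by apply: eq_bigr => v ->.
by apply: eq_bigr => v vt; case: ifP => // /st; rewrite vt.
Qed.

(** * Coefficients along the translates of one cylinder event *)

Section Cylinder.
Variables (s : seq Gam) (B : Gam -> set R).
Hypotheses (us : uniq s) (mB : forall v, measurable (B v)).

(** The box is translated backwards so that [phi x] composed with [shift x] is the original centred
    indicator; pairing a translate of [f] with the latter then amounts to pairing [f] with
    [phi x]. *)
Let phi (x : Gam) := centred (box (shift_seq x^-1%g s) (shift_sets x^-1%g B)).

Let mphi x : measurable (box (shift_seq x^-1%g s) (shift_sets x^-1%g B) : set Om).
Proof. by apply: measurable_box => v; exact: mB. Qed.

Let phi_shift x w : phi x (shift x w) = centred (box s B) w.
Proof.
rewrite /phi -shift_box /centred mu_shift_box//; congr (_ * _ + _).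
by rewrite !indicE; congr (_ (_ : bool))%:R; apply/idP/idP; rewrite !inE /= shiftK.
Qed.

(* The boxes of phi x and phi y depend on disjoint sets of coordinates unless
   y belongs to x s^-1 s. *)
Let phi_gram (l : seq Gam) x : uniq l ->
  \sum_(y <- l) `|dot mu (phi x) (phi y)| <= (size s * size s)%:R.
Proof.
move=> ul; pose near_x := [seq (x * v^-1 * u)%g | v <- s, u <- s].
apply: (@le_trans _ _ (\sum_(y <- l) (y \in near_x)%:R)).
  apply: ler_sum => y _; case: (boolP (y \in near_x)) => [_|ynear].
    by apply: norm_dot_centred_le1; exact: mphi.
  rewrite dot_centred_box_disjoint ?normr0 ?uniq_shift_seq//; [by move=> v; exact: mB..|].
  move=> _ /mapP[v vs ->]; apply/negP => /mapP[u us' e']; move/negP: ynear; apply.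
  apply/allpairsP; exists (v, u); split => //=.
  have -> : u = (v * x^-1 * y)%g by rewrite e' mulgVK.
  by rewrite !mulgA mulgVK mulgV mul1g.
rewrite -natr_sum -[X in X%:R](_ : size [seq y <- l | y \in near_x] = _); last first.
  by rewrite size_filter -sum1_count big_mkcond; apply: eq_bigr => y _; case: ifP.
rewrite ler_nat -(size_allpairs (fun v u => (x * v^-1 * u)%g)).
apply: uniq_leq_size; first exact: filter_uniq.
by move=> y; rewrite mem_filter => /andP[].
Qed.

(** Invariance of [mu] rewrites the coefficients as those of the single function [f] along the
    family [phi], to which the almost orthogonal Bessel inequality applies. *)
Lemma ell2_cylinder_coefficients (f : Om -> R) : sqint mu f ->
  ell2 (fun x => dot mu (f \o shift x) (centred (box s B))).
Proof.
move=> hf.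
have aE x : dot mu (f \o shift x) (centred (box s B)) = dot mu f (phi x).
  rewrite /dot -(Rintegral_shift x (f := fun w => f w * phi x w)).
  - by apply: eq_Rintegral => w _ /=; rewrite phi_shift.
  - by apply: measurable_funM; [exact: hf.1|exact: (sqint_centred (mphi x)).1].
  - by apply: sqintM => //; exact: sqint_centred.
(* The successor keeps [D] positive when [s] is empty. *)
apply/ell2E; pose D : R := (size s * size s).+1%:R.
apply: (proj1 (asum_bound (M := D * dot mu f f) _ _)) => [x|l ul].
  exact: sqr_ge0.
under eq_bigr do rewrite aE.
apply: almost_orthogonal_bessel => // [x|x _].
  exact: sqint_centred.
by apply: le_trans (phi_gram x ul) _; rewrite ler_nat.
Qed.

End Cylinder.

(** The events on which [g] and its mean [c] have equal integrals include the boxes, by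
    orthogonality, and form a Dynkin system; hence they are all the measurable events. *)
Lemma ae_const_of_orthogonal (g : Om -> R) : sqint mu g ->
  (forall s B, uniq s -> (forall v, measurable (B v)) ->
    dot mu g (centred (box s B)) = 0) ->
  exists c, {ae mu, forall w, g w = c}.
Proof.
move=> hg g0; pose c : R := dot mu g \1_setT; exists c.
have mE : measurable_fun [set: Om] (EFin \o g) by apply/measurable_EFinP; exact: hg.1.
have Ig : mu.-integrable [set: Om] (EFin \o g).
  have g1 : (fun w => g w * 1) = g by apply/funext => w; rewrite mulr1.
  by have := sqintM hg (sqint_cst mu 1); rewrite g1.
have Ic (E : set Om) : measurable E -> mu.-integrable E (EFin \o cst c).
  by move=> mE'; exact: finite_measure_integrable_cst.
have IgS (E : set Om) : measurable E -> mu.-integrable E (EFin \o g).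
  by move=> mE'; apply: integrableS Ig.
pose P (E : set Om) := (\int[mu]_(w in E) (g w)%:E = \int[mu]_(w in E) c%:E)%E.
have PT : P setT.
  rewrite /P integral_cst// [X in (_ * X)%E](probability_setT mu) mule1.
  rewrite /c /dot -[LHS]fineK; last exact: integrable_fin_num Ig.
  by congr EFin; apply: eq_Rintegral => w _; rewrite indicT mulr1.
have intE (E : set Om) : measurable E ->
    (\int[mu]_(w in E) (g w)%:E = (dot mu g \1_E)%:E)%E.
  move=> mE'; rewrite integral_mkcond -[LHS]fineK; last first.
    by rewrite -integral_mkcond; exact: integrable_fin_num (IgS _ mE').
  congr EFin; rewrite /dot /Rintegral; congr fine.
  by apply: eq_integral => w _; rewrite epatch_indic /= EFinM.
have Pbox : boxes `<=` P.
  move=> _ [s [B [mB ->]]]; rewrite -box_undup.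
  have mb := measurable_box (undup s) mB.
  rewrite /P intE// integral_cst//.
  have := g0 _ _ (undup_uniq s) mB.
  rewrite dotC dot_lin//; [|exact: sqint_indic|exact: sqint_indic].
  rewrite (dotC _ _ g) (dotC _ (\1_(box _ _)) g) -/c => h.
  transitivity (c * fine (mu (box (undup s) B)))%:E; first by congr EFin; lra.
  by rewrite EFinM; congr (_ * _)%E; rewrite fineK ?fin_num_measure.
(* The integral over [E] is finite and can be cancelled from the equality over the whole space. *)
have PC E : measurable E -> P E -> P (~` E).
  move=> mE' PE; have mC := measurableC mE'.
  have split_int (h : Om -> \bar R) : measurable_fun [set: Om] h ->
      (\int[mu]_w h w = \int[mu]_(w in E) h w + \int[mu]_(w in ~` E) h w)%E.
    move=> mh; rewrite -integral_setU ?setUv//.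
    by apply/disj_setPS; rewrite setICr.
  have := PT; rewrite /P (split_int _ mE) split_int; last exact: measurable_cst.
  have fE : (\int[mu]_(w in E) c%:E)%E \is a fin_num.
    exact: integrable_fin_num (Ic _ mE').
  rewrite [X in (X + _)%E](PE) => h.
  rewrite -[LHS](addeK _ fE) -[RHS](addeK _ fE); congr (_ - _)%E.
  by rewrite addeC h addeC.
have PU (F : (set Om)^nat) : (forall n, measurable (F n)) -> trivIset [set: nat] F ->
    (forall n, P (F n)) -> P (\bigcup_k F k).
  move=> mF tF PF; have mU := bigcup_measurable (fun k _ => mF k).
  rewrite /P !integral_bigcup//; [|exact: Ic|exact: IgS].
  by apply: eq_eseriesr => k _; exact: PF.
have PE (E : set Om) : measurable E -> P E.
  rewrite (Omega_measurableE e_surj).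
  by apply: (dynkin_induction (Omega_measurableE e_surj)) => //; exact: boxesI.
have := integral_ae_eq measurableT Ig (measurable_cst c%:E) (fun E _ mE' => PE E mE').
by apply: filterS => w /(_ I) [].
Qed.

End ShiftOfProductMeasure.

(** * Factors of i.i.d. processes *)

Section AlmostSure.
Context {d} {T : measurableType d} {R : realType} (P : probability T R).

Lemma ae_probability1 (A : set T) : measurable A ->
  {ae P, forall t, A t} <-> P A = 1%E.
Proof.
move=> mA; have mC := measurableC mA.
have eC : P (~` A) = (1 - P A)%E by exact: probability_setC.
split => [/(negligibleP P mC)|PA].
  rewrite [LHS]eC => /eqP; rewrite sube_eq ?add0e// ?fin_num_measure//.
  by move=> /eqP.
by apply/(negligibleP P mC); rewrite [LHS]eC PA subee.
Qed.

Lemma ae_Rintegral (f g : T -> R) :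
  measurable_fun [set: T] f -> measurable_fun [set: T] g ->
  {ae P, forall t, f t = g t} -> \int[P]_t f t = \int[P]_t g t.
Proof.
move=> mf mg fg; rewrite /Rintegral; congr fine; apply: ae_eq_integral => //.
- exact/measurable_EFinP.
- exact/measurable_EFinP.
by apply: filterS fg => t -> _.
Qed.

Lemma sqint_centered_normal (f : T -> R) (s : R) : measurable_fun [set: T] f ->
  (forall B : set R, measurable B -> P (f @^-1` B) = centered_normal s B) ->
  sqint P f.
Proof.
move=> mf law; split => //; apply/integrableP; split.
  by apply/measurable_EFinP; exact: measurable_funM.
have msq : measurable_fun [set: R] (fun x : R => (x ^+ 2)%:E).
  by apply/measurable_EFinP; exact: measurable_funX.
have sq0 (x : R) : (0 <= (x ^+ 2)%:E)%E by rewrite lee_fin sqr_ge0.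
rewrite (_ : (\int[P]_x _)%E =
  \int[P]_(x in f @^-1` setT) ((fun y : R => (y ^+ 2)%:E) \o f) x)%E; last first.
  rewrite preimage_setT; apply: eq_integral => x _ /=.
  by rewrite -expr2 ger0_norm// sqr_ge0.
pose g : T -> measurableTypeR R := f.
have mg : measurable_fun [set: T] g by exact: mf.
rewrite -(ge0_integral_pushforward mg)//.
have [s0|s0] := eqVneq s 0.
  have <- : (\int[\d_(0%R : measurableTypeR R)]_y (y ^+ 2)%:E =
      \int[pushforward P g]_y (y ^+ 2)%:E)%E.
    apply: eq_measure_integral => B mB _.
    by rewrite [RHS]law// /centered_normal s0 eqxx.
  by rewrite integral_dirac// diracT mul1e ltry.
have <- : (\int[normal_prob 0%R s]_y (y ^+ 2)%:E =
      \int[pushforward P g]_y (y ^+ 2)%:E)%E.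
  apply: eq_measure_integral => B mB _.
  by rewrite [RHS]law// /centered_normal (negbTE s0).
exact: normal_prob_second_moment.
Qed.

(** A nondegenerate normal law is absolutely continuous with respect to Lebesgue measure and gives
    no mass to a point. *)
Lemma centered_normal_const (s c : R) : centered_normal s [set c] = 1%E -> s = 0.
Proof.
rewrite /centered_normal; case: eqP => // /eqP s0.
have /null_content_dominatesP dom := @normal_prob_dominates R 0 s.
rewrite dom; [by move=> /eqP; rewrite eq_sym onee_eq0|exact: measurable_set1|].
exact: lebesgue_measure_set1.
Qed.

End AlmostSure.

(** * Countability of the group and its right translations *)

Section FinitelyGenerated.
Context {Gam : groupType}.
Variable S : set Gam.
Hypothesis S_finite : finite_set S.
Hypothesis S_symmetric : symmetric_set S.
Hypothesis S_generates : generates S.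
Local Notation l := (finmap.enum_fset (fset_set S)).

(** Words in the generators are coded by sequences of indices, a countable type; their values
    contain [S] and are closed under products and inverses. *)
Lemma finitely_generated_enum : exists e : nat -> Gam, forall v, exists n, e n = v.
Proof.
pose word (i : seq nat) : Gam := foldr (fun k g => nth 1%g l k * g)%g 1%g i.
have wordM i j : word (i ++ j) = (word i * word j)%g.
  by elim: i => [|k i IH] /=; rewrite ?mul1g// IH mulgA.
have gen s : S s -> exists i, word i = s.
  move=> Ss; exists [:: index s l]; rewrite /= mulg1 nth_index//.
  by rewrite mem_enumS// inE.
have inv1 k : exists i, word i = ((nth 1 l k)^-1)%g.
  have [kl|lk] := ltnP k (size l).
    apply: gen; apply: S_symmetric.
    by have := mem_nth 1%g kl; rewrite mem_enumS// inE.
  (* An index beyond the list stands for the unit, whose inverse is the empty word. *)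
  by exists [::]; rewrite nth_default// invg1.
have rangeT : range word = setT.
  apply: S_generates.
  - by move=> s /gen[i <-]; exists i.
  - by exists [::].
  - by move=> _ _ [i _ <-] [j _ <-]; exists (i ++ j).
  - move=> _ [i _ <-]; elim: i => [|k i [j _ IH]] /=.
      by exists [::]; rewrite //= invg1.
    have [j' e'] := inv1 k.
    by exists (j ++ j') => //; rewrite wordM IH e' invgM.
exists (fun n => word (odflt [::] (unpickle n))) => v.
have : range word v by rewrite rangeT.
by move=> [i _ <-]; exists (pickle i); rewrite pickleK.
Qed.

Lemma rmul_adj (x : Gam) u v : cayley S (u * x)%g (v * x)%g <-> cayley S u v.
Proof.
split=> -[s Ss e]; exists s => //; last by rewrite e mulgA.
by apply: (mulIg x); rewrite e mulgA.
Qed.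

(** The vertex map is multiplication by the inverse of [x]: [act] uses the inverse automorphism, so
    it becomes [shift x]. *)
Definition rmul_aut (x : Gam) : automorphism (cayley S) :=
  Automorphism (mulgVK x) (mulgK x) (rmul_adj x^-1%g).

Lemma act_rmul (R : realType) (x : Gam) (w : Omega R Gam) :
  act (rmul_aut x) w = shift x w.
Proof. by []. Qed.

End FinitelyGenerated.

(** * Equivariant factors satisfying the wave equation *)

Section FactorOfIid.
Context {R : realType} {Gam : groupType}.
Variable S : set Gam.
Hypothesis S_finite : finite_set S.
Hypothesis S_symmetric : symmetric_set S.
Hypothesis S_generates : generates S.
Hypothesis Gam_infinite : infinite_set [set: Gam].
Local Notation l := (finmap.enum_fset (fset_set S)).
Local Notation Om := (Omega R Gam).
Variable e : nat -> Gam.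
Hypothesis e_surj : forall v, exists n, e n = v.
Variable mu : probability Om R.
Variable gamma : set R -> \bar R.
Hypothesis mu_box : forall (s : seq Gam) (B : Gam -> set R), uniq s ->
  (forall v, measurable (B v)) -> mu (box s B) = (\prod_(v <- s) gamma (B v))%E.

Lemma square_integrable_factor_wave_const (F : Om -> Om) v :
  @equivariant R Gam (cayley S) F -> (forall u, sqint mu (fun w => F w u)) ->
  (forall u, {ae mu, forall w,
    adjop l (F w) u = lambda_max R (cayley S) * F w u}) ->
  exists c, {ae mu, forall w, F w v = c}.
Proof.
move=> Feq FL2 Fwave; pose f w := F w 1%g.
(* By equivariance a single function, the value at the identity, determines the whole factor. *)
have FE w u : F w u = f (shift u w).
  have := Feq (rmul_aut S u) w; rewrite !act_rmul /f => ->.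
  by rewrite /shift mul1g.
have hf u : sqint mu (f \o shift u).
  have -> : f \o shift u = fun w => F w u by apply/funext => w; rewrite /= FE.
  exact: FL2.
have f1 : sqint mu f by exact: FL2.
apply: (ae_const_of_orthogonal e_surj) => // s B us mB.
pose h x := dot mu (f \o shift x) (centred mu (box s B)).
have hC : sqint mu (centred mu (box s B)) by apply: sqint_centred; exact: measurable_box.
have hell : ell2 h by exact: (ell2_cylinder_coefficients e_surj mu_box).
have hE : (fun w => F w v) = f \o shift v by apply/funext => w; rewrite /= FE.
rewrite hE -/(h v).
apply: (lambda_max_not_ell2_eigenvalue S_finite S_symmetric S_generates
  Gam_infinite hell) => u.
(* The coefficient 1 gives the sum the form expected by [sqint_sum] and [dot_suml]. *)
pose sum_f w := \sum_(s0 <- l) 1 * (f \o shift (s0 * u)%g) w.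
have hsum : sqint mu sum_f.
  by apply: (@sqint_sum _ _ _ _ _ l (fun=> 1) (fun s0 => f \o shift (s0 * u)%g)).
have -> : adjop l h u = dot mu sum_f (centred mu (box s B)).
  rewrite (@dot_suml _ _ _ _ _ l (fun=> 1) (fun s0 => f \o shift (s0 * u)%g))//.
  by apply: eq_bigr => s0 _; rewrite mul1r.
have hlam := sqintZ (lambda_max R (cayley S)) (hf u).
have -> : lambda_max R (cayley S) * h u =
    dot mu (fun w => lambda_max R (cayley S) * (f \o shift u) w) (centred mu (box s B)).
  rewrite /h /dot -RintegralZl//; last exact: sqintM.
  by apply: eq_Rintegral => w _; rewrite mulrA.
apply: ae_Rintegral.
- by apply: measurable_funM; [exact: hsum.1|exact: hC.1].
- by apply: measurable_funM; [exact: hlam.1|exact: hC.1].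
apply: filterS (Fwave u) => w; rewrite FE /adjop => e1.
congr (_ * _); rewrite -[RHS]e1; apply: eq_bigr => s0 _.
by rewrite mul1r FE.
Qed.

End FactorOfIid.

Theorem theorem6 (R : realType) (Gam : groupType) (S : set Gam)
  (Gam_infinite : infinite_set [set: Gam])
  (S_finite : finite_set S)
  (S_symmetric : symmetric_set S)
  (S_generates : generates S)
  (d : measure_display) (T : measurableType d) (P : probability T R)
  (X : Gam -> {RV P >-> R})
  (X_wave : gaussian_wave_function (cayley S) (lambda_max R (cayley S)) X)
  (X_nontrivial : nontrivial X) :
  ~ law_of_iid_factor (cayley S) X.
Proof.
move=> [d' [T' [P' [Z [F [[Zlaw Zind] mF Feq XF]]]]]].
have [e e_surj] := finitely_generated_enum S_finite S_symmetric S_generates.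
have [Xgauss _ Xeig] := X_wave.
have mX : measurable_fun setT (sample_path X).
  by apply: (measurable_to_Omega e_surj) => v; exact: measurable_funP.
have mZ : measurable_fun setT (sample_path Z).
  by apply: (measurable_to_Omega e_surj) => v; exact: measurable_funP.
pose Zmix := isMeasurableFun.Build _ _ _ _ _ mZ.
pose Zfun : {mfun T' >-> Omega R Gam} := MeasurableFun.Pack (MeasurableFun.Class Zmix).
(* From here the law of [Z] on [Omega] replaces its original probability space. *)
pose mu : probability (Omega R Gam) R := distribution P' Zfun.
have mu_box (s : seq Gam) (B : Gam -> set R) : uniq s -> (forall v, measurable (B v)) ->
    mu (box s B) = (\prod_(v <- s) normal_prob 0%R 1%R (B v))%E.
  by move=> us mB; rewrite -(eq_bigr _ (fun v _ => Zlaw v _ (mB v))) -Zind//.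
have muF (A : set (Omega R Gam)) : measurable A ->
    mu (F @^-1` A) = P (sample_path X @^-1` A).
  by move=> mA; rewrite XF.
have mFv v : measurable_fun [set: Omega R Gam] (fun w => F w v).
  exact: (measurableT_comp (measurable_coord v) mF).
have Flaw v : exists s, forall B : set R, measurable B ->
    P (X v @^-1` B) = centered_normal s B /\
    mu ((fun w => F w v) @^-1` B) = centered_normal s B.
  (* The one-term combination with coefficient 1 gives the marginal at [v]. *)
  have [s hs] := Xgauss [:: v] (fun=> 1); exists s => B mB.
  have XB : P (X v @^-1` B) = centered_normal s B.
    rewrite -hs//; congr (P _); apply/seteqP; split => t /=;
      by rewrite big_cons big_nil mul1r addr0.
  split => //; rewrite -XB.
  have := muF ((fun w : Omega R Gam => w v) @^-1` B); apply.
  by rewrite -[X in measurable X]setTI; exact: measurable_coord.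
have FL2 v : sqint mu (fun w => F w v).
  by have [s hs] := Flaw v; apply: (@sqint_centered_normal _ _ _ _ _ s) => // B /hs[].
have Fwave v : {ae mu, forall w,
    adjop (finmap.enum_fset (fset_set S)) (F w) v = lambda_max R (cayley S) * F w v}.
  (* The wave equation at [v] is a measurable event of the path space, so its probability 1 passes
     from [X] to [F] through the equality of laws. *)
  pose A : set (Omega R Gam) := [set w |
    adjop (finmap.enum_fset (fset_set S)) w v = lambda_max R (cayley S) * w v].
  have mA : measurable A.
    pose g (w : Omega R Gam) := adjop (finmap.enum_fset (fset_set S)) w v -
      lambda_max R (cayley S) * w v.
    have mg : measurable_fun setT g.
      apply: measurable_funB.
        by apply: measurable_sum => s; exact: measurable_coord.
      by apply: measurable_funM => //; exact: measurable_coord.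
    have -> : A = setT `&` g @^-1` [set 0].
      rewrite setTI; apply/seteqP; split => w /=; rewrite /A /g /= => /eqP.
        by rewrite -subr_eq0 => /eqP.
      by rewrite subr_eq0 => /eqP.
    exact: mg.
  have mFA : measurable (F @^-1` A) by rewrite -[X in measurable X]setTI; exact: mF.
  have mXA : measurable (sample_path X @^-1` A).
    by rewrite -[X in measurable X]setTI; exact: mX.
  apply/(ae_probability1 mu mFA); rewrite muF//; apply/(ae_probability1 P mXA).
  by apply: filterS (Xeig v) => t; rewrite sum_neighbors.
apply: X_nontrivial.
have X0 v : {ae P, forall t, X v t = 0}.
  have [c Fc] := square_integrable_factor_wave_const S_finite S_symmetric S_generates
    Gam_infinite e_surj mu_box v Feq FL2 Fwave.
  have [s hs] := Flaw v.
  have m0 (x : R) : measurable (X v @^-1` [set x]).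
    by rewrite -[X in measurable X]setTI; exact: measurable_funP.
  have s0 : s = 0.
    apply: (centered_normal_const (c := c)); have [_ <-] := hs _ (measurable_set1 c).
    apply/ae_probability1 => //.
    by rewrite -[X in measurable X]setTI; exact: mFv.
  apply/(ae_probability1 P (m0 0)); have [-> _] := hs _ (measurable_set1 0).
  by rewrite /centered_normal s0 eqxx /= diracE mem_set.
(* The exceptional events of all vertices are gathered into one null event along the enumeration
   [e]. *)
have := negligible_bigcup (fun n => X0 (e n)); apply: negligibleS => t /= /existsNP[v Xv].
by have [n en] := e_surj v; exists n => //; rewrite en.
Qed.
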